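(* Let $X\subset\mathbb{R}^d$ be a finite point cloud in general position, and let $k\geq 0$. Then the $k$-th Rips and Delaunay--Rips persistence modules $\big(H_k(\mathcal{R}_r(X))\big)_{r\geq0}$ and $\big(H_k(\mathcal{DR}_r(X))\big)_{r\geq0}$ are multiplicatively strongly $c_{k+1}$-interleaved, where $c_{m}=\sqrt{2m/(m+1)}$. Consequently, $$W_\infty\big(\log \mathrm{Dgm}^k_{\mathcal{DR}}(X),\ \log \mathrm{Dgm}^k_{\mathcal{R}}(X)\big)\leq \log c_{k+1}.$$
   Context: General position: no $d+1$ points of $X$ lie on a common affine hyperplane and no $d+2$ points lie on a common $(d-1)$-sphere, so that the Delaunay complex $\mathsf{DEL}(X)$ (an abstract simplicial complex on vertex set $X$) is well defined. For a finite set $\sigma$, $\delta(\sigma)=\max_{x,y\in\sigma}\|x-y\|_2$ is its diameter. The Rips filtration is $\mathcal{R}_r(X)=\{\sigma\subseteq X,\ \sigma\neq\varnothing : \delta(\sigma)\le 2r\}$ and the Delaunay--Rips filtration is $\mathcal{DR}_r(X)=\{\sigma\in\mathsf{DEL}(X): \delta(\sigma)\le 2r\}$, for $r\ge0$. Homology is taken with coefficients in a field; the persistence module of a filtration consists of the groups $H_k(\mathcal{F}_r)$ with the maps induced by inclusions. Two persistence modules $(V_r)_{r\ge0},(W_r)_{r\ge0}$ are multiplicatively strongly $\eta$-interleaved ($\eta\ge1$) if there are linear maps $\Phi_r:V_r\to W_{\eta r}$ and $\Psi_r:W_r\to V_{\eta r}$ for all $r\ge0$ such that $\Psi_{\eta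 r}\circ\Phi_r$ and $\Phi_{\eta r}\circ\Psi_r$ equal the structure maps $V_r\to V_{\eta^2 r}$, $W_r\to W_{\eta^2 r}$, and $\Phi,\Psi$ commute with the structure maps ($\Phi_{r'}\circ(V_r\to V_{r'}) = (W_{\eta r}\to W_{\eta r'})\circ\Phi_r$ for $r\le r'$, and similarly for $\Psi$). $\mathrm{Dgm}^k_{\mathcal{F}}(X)$ is the $k$-dimensional persistence diagram (multiset of birth–death pairs $(b,d)$, possibly $d=\infty$) of the filtration; $\log D=\{(\log b,\log d):(b,d)\in D\}$ with $\log 0=-\infty$, $\log\infty=\infty$ (coordinates equal to $\pm\infty$ being matched with zero cost to equal infinite coordinates). $W_\infty$ is the bottleneck distance: the infimum over bijections between the diagrams augmented by diagonal points of the maximal $\ell^\infty$ cost, where pairs of diagonal points cost $0$. *)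

(* Defs.v *)
From HB Require Import structures.
From mathcomp Require Import all_boot all_order all_algebra.
From mathcomp Require Import boolp reals constructive_ereal ereal.
From mathcomp Require Import exp.
Set Implicit Arguments.
Unset Strict Implicit.
Unset Printing Implicit Defensive.
Import Order.TTheory GRing.Theory Num.Theory.
Local Open Scope ring_scope.

Section Geometry.
Variables (R : realType) (d n : nat) (p : 'I_n -> 'rV[R]_d).

Definition edist2 (x y : 'rV[R]_d) : R :=
  Num.sqrt (\sum_(i < d) (x ord0 i - y ord0 i) ^+ 2).

Definition diam (s : {set 'I_n}) : R :=
  \big[Num.max/0]_(i in s) \big[Num.max/0]_(j in s) edist2 (p i) (p j).

Definition no_hyperplane : Prop :=
  forall S : {set 'I_n}, #|S| = d.+1 ->
    ~ exists (a : 'rV[R]_d) (b : R),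
        a != 0 /\ forall i, i \in S -> \sum_(j < d) a ord0 j * p i ord0 j = b.

Definition no_sphere : Prop :=
  forall S : {set 'I_n}, #|S| = d.+2 ->
    ~ exists (c : 'rV[R]_d) (rho : R),
        0 < rho /\ forall i, i \in S -> edist2 c (p i) = rho.

Definition general_position : Prop := no_hyperplane /\ no_sphere.

(* Delaunay complex: nerve of the Voronoi cells, i.e. the nonempty sigma
   for which some point c is (weakly) closest to every vertex of sigma. *)
Definition is_del (s : {set 'I_n}) : bool :=
  (s != set0) &&
  `[< exists c : 'rV[R]_d,
        forall i, i \in s -> forall j : 'I_n, edist2 c (p i) <= edist2 c (p j) >].

Definition filt (K : pred {set 'I_n}) (r : R) : pred {set 'I_n} :=
  fun s => K s && (diam s <= 2 * r).

Definition rips_cplx : pred {set 'I_n} := fun s => s != set0.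
Definition rips := filt rips_cplx.
Definition drips := filt is_del.

End Geometry.

(* Vertices are oriented by the order of 'I_n.                         *)
Section Homology.
Variables (F : fieldType) (n : nat).

Definition chain := {ffun {set 'I_n} -> F^o}.

Definition chi (s : {set 'I_n}) : chain := [ffun t => (t == s)%:R].

Definition chainsp (K : pred {set 'I_n}) (k : nat) : {vspace chain} :=
  <<[seq chi s | s <- enum [pred s | K s && (#|s| == k.+1)]]>>%VS.

(* (non-augmented) simplicial boundary:
   d[v_0,...,v_k] = sum_i (-1)^i [v_0,..,^v_i,..,v_k]  (k >= 1), d[v] = 0 *)
Definition bnd_fun (c : chain) : chain :=
  [ffun t => if t == set0 then 0 else
     \sum_(v : 'I_n | v \notin t) (-1) ^+ #|[set u in t | (u < v)%N]| * c (v |: t)].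

Definition bnd : 'End(chain) := linfun bnd_fun.

Definition cycles (K : pred {set 'I_n}) (k : nat) : {vspace chain} :=
  (chainsp K k :&: lker bnd)%VS.

Definition bdries (K : pred {set 'I_n}) (k : nat) : {vspace chain} :=
  (bnd @: chainsp K k.+1)%VS.

(* H_k(K) = cycles K k / bdries K k.  A linear map H_k(K) -> H_k(L) is
   represented by a chain-level linear map f sending cycles to cycles and
   boundaries to boundaries (every linear map of quotients lifts). *)
Definition induces (K L : pred {set 'I_n}) (k : nat) (f : 'End(chain)) : bool :=
  (f @: cycles K k <= cycles L k)%VS && (f @: bdries K k <= bdries L k)%VS.

(* Two such maps H_k(K) -> H_k(L) are equal iff they agree modulo
   boundaries of L on cycles of K.  Maps induced by inclusions are the
   identity on chains. *)
Definition homeq (K L : pred {set 'I_n}) (k : nat) (f g : 'End(chain)) : Prop :=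
  forall z, z \in cycles K k -> f z - g z \in bdries L k.

Definition mult_strongly_interleaved (R : realType)
    (V W : R -> pred {set 'I_n}) (k : nat) (eta : R) : Prop :=
  1 <= eta /\
  exists Phi Psi : R -> 'End(chain),
    (forall r, 0 <= r -> induces (V r) (W (eta * r)) k (Phi r)) /\
    (forall r, 0 <= r -> induces (W r) (V (eta * r)) k (Psi r)) /\
    (forall r, 0 <= r ->
       homeq (V r) (V (eta ^+ 2 * r)) k (Psi (eta * r) \o Phi r)%VF \1%VF) /\
    (forall r, 0 <= r ->
       homeq (W r) (W (eta ^+ 2 * r)) k (Phi (eta * r) \o Psi r)%VF \1%VF) /\
    (forall r r', 0 <= r -> r <= r' ->
       homeq (V r) (W (eta * r')) k (Phi r') (Phi r)) /\
    (forall r r', 0 <= r -> r <= r' ->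
       homeq (W r) (V (eta * r')) k (Psi r') (Psi r)).

(* rank of the map H_k(K) -> H_k(L) induced by inclusion K subset L:
   dim of the image (Z_k(K) + B_k(L)) / B_k(L). *)
Definition rank_map (K L : pred {set 'I_n}) (k : nat) : nat :=
  (\dim (cycles K k + bdries L k)%VS - \dim (bdries L k))%N.

End Homology.

(* Persistence diagrams (via the rank function / inclusion-exclusion)  *)
(* of the filtration r |-> filt p K r, whose critical values are the   *)
(* diam(sigma)/2, sigma in K.  Points (b, d) with d = +oo allowed.     *)
Section Diagram.
Variables (R : realType) (F : fieldType) (d n : nat) (p : 'I_n -> 'rV[R]_d).
Variables (K : pred {set 'I_n}) (k : nat).

Definition crit : seq R := sort <=%R (undup [seq diam p s / 2 | s <- enum K]).

Definition rkv (a b : nat) : int :=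
  (rank_map F (filt p K (nth 0 crit a)) (filt p K (nth 0 crit b)) k)%:Z.

Definition rkv0 (a b : nat) : int := if a is a'.+1 then rkv a' b else 0.

Definition mult_fin (i j : nat) : int :=
  rkv i j.-1 - rkv0 i j.-1 - rkv i j + rkv0 i j.

Definition mult_inf (i : nat) : int :=
  rkv i (size crit).-1 - rkv0 i (size crit).-1.

Definition dgm : seq (R * \bar R) :=
  flatten [seq nseq `|mult_fin i j|%N (nth 0 crit i, (nth 0 crit j)%:E)
          | i <- iota 0 (size crit), j <- iota i.+1 (size crit - i.+1)]
  ++ flatten [seq nseq `|mult_inf i|%N (nth 0 crit i, +oo%E)
             | i <- iota 0 (size crit)].

End Diagram.

Section Bottleneck.
Variable R : realType.
Local Open Scope ereal_scope.

Definition elog (x : \bar R) : \bar R :=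
  match x with
  | EFin r => if r == 0%R then -oo else (ln r)%:E
  | +oo => +oo
  | -oo => -oo
  end.

Definition logdgm (D : seq (R * \bar R)) : seq (\bar R * \bar R) :=
  [seq (elog (x.1)%:E, elog x.2) | x <- D].

(* |a - b|, with equal infinite coordinates at distance 0 *)
Definition ecoord_dist (a b : \bar R) : \bar R :=
  if a == b then 0 else `|a - b|.

Definition pt_cost (x y : \bar R * \bar R) : \bar R :=
  maxe (ecoord_dist x.1 y.1) (ecoord_dist x.2 y.2).

(* l^oo distance of (b,d) to the diagonal *)
Definition diag_cost (x : \bar R * \bar R) : \bar R :=
  (x.2 - x.1) * (2^-1)%:E.

Definition pmatching (D1 D2 : seq (\bar R * \bar R)) (m : seq (nat * nat)) : bool :=
  [&& uniq (unzip1 m), uniq (unzip2 m) &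
      all (fun ij => (ij.1 < size D1)%N && (ij.2 < size D2)%N) m].

Definition mcost (D1 D2 : seq (\bar R * \bar R)) (m : seq (nat * nat)) : \bar R :=
  maxe (\big[maxe/0]_(ij <- m) pt_cost (nth (0,0) D1 ij.1) (nth (0,0) D2 ij.2))
   (maxe (\big[maxe/0]_(i <- iota 0 (size D1) | i \notin unzip1 m)
             diag_cost (nth (0,0) D1 i))
         (\big[maxe/0]_(j <- iota 0 (size D2) | j \notin unzip2 m)
             diag_cost (nth (0,0) D2 j))).

Definition bottleneck (D1 D2 : seq (\bar R * \bar R)) : \bar R :=
  ereal_inf (fun e => exists2 m, pmatching D1 D2 m & mcost D1 D2 m = e).

End Bottleneck.

Definition cconst (R : realType) (m : nat) : R :=
  Num.sqrt (2 * m%:R / m.+1%:R).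

(* Main.v *)
Require Import Defs.
From HB Require Import structures.
From mathcomp Require Import classical_sets topology normedtype derive.
From mathcomp Require Import all_boot all_order all_algebra.
From mathcomp Require Import boolp reals constructive_ereal ereal.
From mathcomp Require Import exp.
From mathcomp Require Import zify ring lra.
Set Implicit Arguments.
Unset Strict Implicit.
Unset Printing Implicit Defensive.
Import Order.TTheory GRing.Theory Num.Theory.
Import numFieldNormedType.Exports.
Local Open Scope ring_scope.

(* Call a simplex Cech at scale [s] if it lies in a ball of squared radius [s], and let
   DelCech be the complex of the Delaunay simplices that are Cech.  By Jung's theorem the
   [k+1]-skeleton of the Rips complex at [r] lies in the Cech complex at [(c r)^2],
   [c = c_(k+1)], and Delaunay-Rips simplices lie in DelCech likewise; conversely a Cech
   (DelCech) simplex at [r^2] is a Rips (Delaunay-Rips) simplex at [r].  So the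
   interleaving follows once the pair (Cech, DelCech) has no homology.

   This holds for arbitrary finite point clouds.  For a convex set [Theta] of real
   functions on the vertices, let [K_E] consist of the simplices on which some
   [f \in Theta] with [f >= 0] on [E] is nonpositive.  A simplex [Q] of [K_E] outside
   [K_(E + x)] can be toggled at [x]: its witness is negative at [x], so [x] can be added,
   and if [Q - x] were in [K_(E + x)], a convex combination of the two witnesses vanishing
   at [x] would put [Q] in [K_(E + x)].  Hence [K_0] and [K_X] have the same homology.
   For the functions [a |y|^2 + affine] ([a > 0]) that dominate [|y - z|^2 - s] for some
   [z], [K_0] is the Cech complex and [K_X] consists of the faces of the Delaunay cells
   that are themselves Cech.  The Delaunay cells that are not Cech, which only matter when
   the Delaunay complex is degenerate, are removed by induction, applying the same
   argument inside one cell.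

   For the bottleneck bound, let [Z], [B] be the cycles and boundaries of the
   Delaunay-Rips ([D]) and Rips ([R]) filtrations.  The bars of [im (H D_r -> H R_r)],
   i.e. of the pair [(Z D, B R)], inject into those of [(Z D, B D)] keeping births, and
   into those of [(Z R, B R)] keeping deaths, by sorting the bars with a common birth or
   death; the composite is the matching. *)

(** * Vanishing of relative homology *)

Section RelativeAcyclicity.
Variables (F : fieldType) (n : nat).
Implicit Types (c z w : chain F n) (A B D : pred {set 'I_n}) (s t : {set 'I_n}).

Lemma bnd_fun_linear : linear (@bnd_fun F n).
Proof.
move=> a c c'; apply/ffunP => t; rewrite !ffunE.
case: (t == set0); first by rewrite scaler0 addr0.
rewrite scaler_sumr -big_split; apply: eq_bigr => v _ /=.
by rewrite !ffunE mulrDr /= /GRing.scale /= mulrCA.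
Qed.

HB.instance Definition _ :=
  GRing.isLinear.Build F (chain F n) (chain F n) _ (@bnd_fun F n) bnd_fun_linear.

Lemma bndE c : bnd F n c = bnd_fun c. Proof. exact: lfunE. Qed.

Lemma bnd_fun_comp c : bnd_fun (bnd_fun c) = 0.
Proof.
apply/ffunP => t; rewrite [LHS]ffunE [RHS]ffunE.
case: eqP => // /eqP t0.
pose g (v u : 'I_n) : F := (-1) ^+ #|[set x in t | (x < v)%N]| *
  ((-1) ^+ #|[set x in v |: t | (x < u)%N]| * c (u |: (v |: t))).
transitivity (\sum_(v | v \notin t) \sum_(u | (u \notin t) && (u != v)) g v u).
  apply: eq_bigr => v vt; rewrite ffunE.
  rewrite (negPf (_ : v |: t != set0)); last by apply/set0Pn; exists v; rewrite setU11.
  rewrite mulr_sumr.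
  by apply: eq_big => // u; rewrite in_setU1 negb_or andbC.
(* The pairs are split by the order of [u] and [v]. After an exchange of sums the halves cancel,
   because inserting the smaller vertex first shifts one sign exponent by one. *)
transitivity (\sum_(v | v \notin t) \sum_(u | (u \notin t) && (u < v)%N) g v u +
              \sum_(v | v \notin t) \sum_(u | (u \notin t) && (v < u)%N) g v u).
  rewrite -big_split; apply: eq_bigr => v vt /=.
  rewrite (bigID (fun u : 'I_n => (u < v)%N)) /=; congr (_ + _); apply: eq_bigl => u.
    by rewrite -andbA; congr (_ && _); rewrite -(inj_eq val_inj) /=; lia.
  by rewrite -andbA; congr (_ && _); rewrite -(inj_eq val_inj) /=; lia.
rewrite [X in _ + X](exchange_big_dep (fun u => u \notin t)) /=; last first.
  by move=> v u _ /andP[].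
rewrite -big_split big1 //= => v vt.
rewrite [X in _ + X](eq_bigl (fun u => (u \notin t) && (u < v)%N)); last first.
  by move=> u; rewrite vt.
rewrite -big_split big1 //= => u /andP[ut uv].
have E1 : [set x in v |: t | (x < u)%N] = [set x in t | (x < u)%N].
  apply/setP => x; rewrite !inE; case: eqP => // ->.
  by rewrite (negPf vt) /=; apply/negbTE; lia.
have E2 : [set x in u |: t | (x < v)%N] = u |: [set x in t | (x < v)%N].
  by apply/setP => x; rewrite !inE; case: eqP => // ->; rewrite uv.
rewrite /g E1 E2 cardsU1 !inE (negPf ut) /= add1n exprS (setUCA [set u]).
ring.
Qed.

(** Chains of all degrees are treated at once; the grading returns in [rel_acyclic_graded]. *)
Definition supported A c := forall t, ~~ A t -> c t = 0.

Definition face_closed A := forall s t, A s -> t \subset s -> t != set0 -> A t.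

(* For a pair of complexes [B <= A]: the homology of the pair vanishes. *)
Definition rel_acyclic A B := forall z, supported A z -> supported B (bnd_fun z) ->
  exists2 w, supported A w & supported B (z - bnd_fun w).

Lemma supportedB A c c' : supported A c -> supported A c' -> supported A (c - c').
Proof. by move=> sc sc' t nt; rewrite !ffunE sc // sc' // subr0. Qed.

Lemma supportedD A c c' : supported A c -> supported A c' -> supported A (c + c').
Proof. by move=> sc sc' t nt; rewrite !ffunE sc // sc' // addr0. Qed.

Lemma supported0 A : supported A 0. Proof. by move=> t _; rewrite ffunE. Qed.

Lemma sub_supported A B c : subpred A B -> supported A c -> supported B c.
Proof. by move=> sAB sc t nt; apply: sc; apply: contra nt; apply: sAB. Qed.

Lemma supported_bnd A c : face_closed A -> supported A c -> supported A (bnd_fun c).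
Proof.
move=> dA sc t nt; rewrite ffunE; case: eqP => // /eqP t0.
rewrite big1 // => v _; rewrite sc ?mulr0 //; apply: contra nt => /dA; apply => //.
exact: subsetUr.
Qed.

Lemma rel_acyclic_refl A : rel_acyclic A A.
Proof.
move=> z sz _; exists 0; first exact: supported0.
by rewrite linear0 subr0.
Qed.

Lemma rel_acyclic_trans A B D : subpred B A -> subpred D B ->
  rel_acyclic A B -> rel_acyclic B D -> rel_acyclic A D.
Proof.
move=> BA DB rAB rBD z sz sdz.
have [w sw szw] := rAB z sz (sub_supported DB sdz).
have [|u su szu] := rBD _ szw; first by rewrite linearB /= bnd_fun_comp subr0.
exists (w + u); first by apply: supportedD => //; apply: sub_supported su.
by rewrite linearD /= opprD addrA.
Qed.

(** From the exact sequence of the triple: [bnd_fun z] is a cycle of the pair ([B], [D]), so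
    subtracting a suitable chain of [B] turns [z] into a relative cycle of ([A], [D]). *)
Lemma rel_acyclic_2of3 A B D : subpred B A -> subpred D B -> face_closed B ->
  rel_acyclic A D -> rel_acyclic B D -> rel_acyclic A B.
Proof.
move=> BA DB dB rAD rBD z sz sdz.
have [|w sw szw] := rBD _ sdz.
  by rewrite bnd_fun_comp; apply: supported0.
have [||u su szu] := rAD (z - w).
- by apply: supportedB => //; apply: sub_supported sw.
- by rewrite linearB.
exists u => //; rewrite -[z](subrK w) addrAC.
by apply: supportedD => //; apply: sub_supported szu.
Qed.

Definition restr A c : chain F n := [ffun t => if A t then c t else 0].

(** Both pairs have the same relative chains, those on the simplices outside the subcomplex;
    restriction to these simplices carries chains from one pair to the other. *)
Lemma rel_acyclic_excision A B A' B' :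
  face_closed A -> face_closed B -> face_closed A' -> face_closed B' ->
  (forall t, A t && ~~ B t = A' t && ~~ B' t) ->
  rel_acyclic A' B' -> rel_acyclic A B.
Proof.
move=> dA dB dA' dB' E r z sz sdz.
pose z1 := restr (fun t => A t && ~~ B t) z.
have sz1 : supported A' z1.
  by move=> t nt; rewrite ffunE E (negPf nt).
have szz1 : supported B (z - z1).
  move=> t nt; rewrite !ffunE nt andbT; case: ifP => At; rewrite ?subrr //.
  by rewrite sz ?At // subr0.
have sd1 : supported B (bnd_fun z1).
  rewrite -[z1](subKr z) linearB /=; apply: supportedB => //.
  exact: supported_bnd.
have sd1' : supported B' (bnd_fun z1).
  move=> t nt; have [A't|nA't] := boolP (A' t); last exact: (supported_bnd dA' sz1).
  by apply: sd1; move: (E t); rewrite A't nt /= => /andP[].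
have [w sw szw] := r _ sz1 sd1'.
pose w1 := restr (fun t => A t && ~~ B t) w.
have sw1 : supported A w1 by move=> t nt; rewrite ffunE (negPf nt).
have sww1 : supported B' (w - w1).
  move=> t nt; rewrite !ffunE E nt andbT; case: ifP => At; rewrite ?subrr //.
  by rewrite sw ?At // subr0.
exists w1 => // t nt.
have [At|nAt] := boolP (A t); last first.
  by rewrite [LHS]ffunE sz // [X in _ + X]ffunE (supported_bnd dA sw1) // subr0.
have /andP[A't nB't] : A' t && ~~ B' t by rewrite -E At.
have -> : z - bnd_fun w1 = (z - z1) + (z1 - bnd_fun w) + bnd_fun (w - w1).
  by rewrite linearB /= !addrA !subrK.
by rewrite ffunE (supported_bnd dB' sww1 nB't) ffunE (szz1 t nt) (szw t nB't) !addr0.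
Qed.

(** Coning with apex [x] contracts the relative chains: subtracting the boundary of the cone [w]
    kills the coefficients of [z] on simplices without [x], and a relative cycle of this kind
    vanishes outside [B]. *)
Lemma rel_acyclic_toggle A B (x : 'I_n) : face_closed A -> face_closed B ->
  ~~ A set0 ->
  (forall t, A t -> ~~ B t -> [&& A (x |: t), ~~ B (x |: t), A (t :\ x) & ~~ B (t :\ x)]) ->
  rel_acyclic A B.
Proof.
move=> dA dB nA0 tog z sz sdz.
pose w : chain F n := [ffun t : {set 'I_n} => if [&& x \in t, A t & ~~ B t] then
   (-1) ^+ #|[set u in t | (u < x)%N]| * z (t :\ x) else 0].
have sw : supported A w by move=> t nt; rewrite ffunE (negPf nt) andbF.
(* [bnd_fun] is set to 0 at the empty set, so coefficients can be read off only at nonempty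
   simplices. *)
have ndif t : A t -> ~~ B t -> t != set0 by move=> At _; apply: contraNneq nA0 => <-.
exists w => //; pose y := z - bnd_fun w; rewrite -/y.
have sy : supported A y by apply: supportedB => //; apply: supported_bnd.
have sdy : supported B (bnd_fun y).
  by rewrite /y linearB /= bnd_fun_comp subr0.
have y0 t : A t -> ~~ B t -> x \notin t -> y t = 0.
  move=> At nBt xt; have /and4P[Axt nBxt _ _] := tog t At nBt.
  rewrite !ffunE (negPf (ndif t At nBt)) (bigD1 x) //= big1 => [|v /andP[vt vx]].
    rewrite addr0 ffunE setU11 Axt nBxt /= setU1K // mulrA.
    have -> : [set u in x |: t | (u < x)%N] = [set u in t | (u < x)%N].
      by apply/setP => u; rewrite !inE; case: eqP => // ->; rewrite ltnn !andbF.
    by rewrite -expr2 sqrr_sign mul1r subrr.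
  by rewrite ffunE in_setU1 eq_sym (negPf vx) (negPf xt) /= mulr0.
move=> t nBt; have [At|nAt] := boolP (A t); last exact: sy.
have [xt|] := boolP (x \in t); last exact: y0.
have /and4P[_ _ Atx nBtx] := tog t At nBt.
(* Among the cofaces of [t :\ x] only [t] contains [x], so the coefficient of [bnd_fun y] there is
   [y t] up to sign. *)
have ntx := ndif _ Atx nBtx; have := sdy _ nBtx.
rewrite ffunE (negPf ntx) (bigD1 x) ?setD11 //= setD1K // big1 ?addr0.
  by move/eqP; rewrite mulf_eq0 signr_eq0 => /eqP.
move=> v /andP[vt vx].
have xv : x \notin v |: (t :\ x) by rewrite !inE eqxx eq_sym (negPf vx).
have [Av|nAv] := boolP (A (v |: (t :\ x))); last by rewrite sy ?mulr0.
have nBv : ~~ B (v |: (t :\ x)).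
  apply: contra nBtx => /dB; apply; [exact: subsetUr|exact: ntx].
by rewrite (y0 _ Av nBv xv) mulr0.
Qed.

Lemma eq_rel_acyclic A B A' B' : A =1 A' -> B =1 B' ->
  rel_acyclic A B -> rel_acyclic A' B'.
Proof. by move=> eA eB; rewrite (funext eA) (funext eB). Qed.

End RelativeAcyclicity.

(** * The Cech and the Delaunay-Cech complexes *)

Section ConvexFamily.
Variables (F : fieldType) (R : realType) (n : nat).
Variables (Y : {set 'I_n}) (Theta : ('I_n -> R) -> Prop).

Definition sublevel_cplx (E : {set 'I_n}) : pred {set 'I_n} := fun Q =>
  [&& Q != set0, Q \subset Y &
   `[< exists f, [/\ Theta f, forall i, i \in Q -> f i <= 0 & forall i, i \in E -> 0 <= f i] >]].

Lemma sublevel_face_closed E : face_closed (sublevel_cplx E).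
Proof.
move=> s t /and3P[_ sY /asboolP[f [Tf fs fE]]] ts t0.
rewrite /sublevel_cplx t0 (subset_trans ts sY); apply/asboolP; exists f; split=> // i it.
by apply: fs; apply: (subsetP ts).
Qed.

Hypothesis Theta_convex : forall f g (t : R), 0 <= t <= 1 -> Theta f -> Theta g ->
  Theta (fun i => (1 - t) * f i + t * g i).
Hypothesis Theta_ge0 : exists2 f, Theta f & forall i, i \in Y -> 0 <= f i.

Lemma sublevel_rel_acyclic_step (E : {set 'I_n}) x : E \subset Y -> x \in Y ->
  rel_acyclic F (sublevel_cplx E) (sublevel_cplx (x |: E)).
Proof.
move=> EY xY; apply: (@rel_acyclic_toggle F n _ _ x).
- exact: sublevel_face_closed.
- exact: sublevel_face_closed.
- by rewrite /sublevel_cplx eqxx.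
move=> Q AQ nBQ; have /and3P[Q0 QY /asboolP[f [Tf fQ fE]]] := AQ.
have fx : f x < 0.
  rewrite ltNge; apply: contra nBQ => fx; rewrite /sublevel_cplx Q0 QY.
  apply/asboolP; exists f; split => // i /setU1P[->|] //; exact: fE.
have noext : ~ exists g, [/\ Theta g, forall i, i \in Q :\ x -> g i <= 0
    & forall i, i \in x |: E -> 0 <= g i].
  move=> [g [Tg gQ gE]]; have gx : 0 <= g x by apply: gE; rewrite setU11.
  (* The weight at which the combination of [f] and [g] vanishes at [x]; it lies in [[0, 1]] as
     [f x < 0 <= g x]. *)
  pose t := f x / (f x - g x).
  have fgx : f x - g x < 0 by lra.
  have t01 : 0 <= t <= 1.
    rewrite /t -mulrNN -invrN divr_ge0 ?oppr_ge0 ?(ltW fx) ?(ltW fgx) //=.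
    by rewrite ler_pdivrMr; lra.
  have tx : (1 - t) * f x + t * g x = 0.
    by rewrite /t; field; rewrite lt_eqF.
  move/negP: nBQ; apply; rewrite /sublevel_cplx Q0 QY; apply/asboolP.
  have /andP[t0 t1] := t01.
  exists (fun i => (1 - t) * f i + t * g i); split; first exact: Theta_convex.
    move=> i iQ; have [->|ix] := eqVneq i x; first by rewrite tx.
    have := fQ i iQ; have := gQ i; rewrite !inE ix iQ => /(_ isT); nra.
  move=> i /setU1P[->|iE]; first by rewrite tx.
  have := fE i iE; have := gE i; rewrite !inE iE orbT => /(_ isT); nra.
apply/and4P; split.
- rewrite /sublevel_cplx subUset sub1set xY QY /=; apply/andP; split.
    by apply/set0Pn; exists x; rewrite setU11.
  by apply/asboolP; exists f; split => // i /setU1P[->|/fQ//]; apply: ltW.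
- apply: contra nBQ => B; apply: (sublevel_face_closed B _ Q0); exact: subsetUr.
- apply: (sublevel_face_closed AQ); first exact: subsetDl.
  (* Were [Q :\ x] empty, the member of [Theta] that is nonnegative on [Y] would be a witness
     excluded by [noext]. *)
  apply/eqP => e; apply: noext; case: Theta_ge0 => g Tg gY; exists g; split => // i.
    by rewrite e inE.
  by move=> iE; apply: gY; move: i iE; apply/subsetP; rewrite subUset sub1set xY.
- apply/negP => /and3P[_ _ /asboolP]; exact: noext.
Qed.

Lemma sublevel_rel_acyclic (E : {set 'I_n}) : E \subset Y ->
  rel_acyclic F (sublevel_cplx set0) (sublevel_cplx E).
Proof.
have [m] := ubnP #|E|; elim: m E => // m IH E Em EY.
have [->|/set0Pn[x xE]] := eqVneq E set0; first exact: rel_acyclic_refl.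
have E'Y : E :\ x \subset Y by apply: subset_trans EY; apply: subsetDl.
have xY : x \in Y by apply: (subsetP EY).
have mono (D D' : {set 'I_n}) : D' \subset D -> subpred (sublevel_cplx D) (sublevel_cplx D').
  move=> sD Q /and3P[Q0 QY /asboolP[f [Tf fQ fE]]].
  rewrite /sublevel_cplx Q0 QY; apply/asboolP; exists f; split=> // i /(subsetP sD).
  exact: fE.
apply: (@rel_acyclic_trans F n _ (sublevel_cplx (E :\ x))).
- by apply: mono; apply: sub0set.
- by apply: mono; apply: subsetDl.
- by apply: IH => //; rewrite (cardsD1 x) xE in Em.
- by rewrite -{2}(setD1K xE); apply: sublevel_rel_acyclic_step.
Qed.

End ConvexFamily.

(** * Paraboloids, Delaunay cells and simplices in balls *)

Section Cells.
Variables (F : fieldType) (R : realType) (d n : nat) (p : 'I_n -> 'rV[R]_d).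
Implicit Types (x y z : 'rV[R]_d) (f g : 'I_n -> R) (C Q : {set 'I_n}).

Definition sqdist x y : R := \sum_(j < d) (x ord0 j - y ord0 j) ^+ 2.

Lemma edist2_le x y x' y' :
  (edist2 x y <= edist2 x' y') = (sqdist x y <= sqdist x' y').
Proof. by rewrite ler_sqrt // sumr_ge0 // => j _; apply: sqr_ge0. Qed.

Lemma sqdist_convex x x' y (t : R) : 0 <= t <= 1 ->
  sqdist ((1 - t) *: x + t *: x') y <= (1 - t) * sqdist x y + t * sqdist x' y.
Proof.
move=> /andP[t0 t1]; rewrite !mulr_sumr -big_split ler_sum // => j _ /=.
rewrite !mxE; have : 0 <= t * (1 - t) * (x ord0 j - x' ord0 j) ^+ 2.
  by apply: mulr_ge0 (sqr_ge0 _); rewrite mulr_ge0 ?subr_ge0.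
nra.
Qed.

(* Restrictions to the point cloud of the functions [a |y|^2 + <b, y> + e], [a > 0]:
   up to a positive factor, powers with respect to spheres (of any real squared radius). *)
Definition paraboloid f := exists a (b : 'rV[R]_d) e, 0 < a /\
  forall i, f i = a * (\sum_j p i ord0 j ^+ 2) + (\sum_j b ord0 j * p i ord0 j) + e.

Lemma paraboloidD f g : paraboloid f -> paraboloid g -> paraboloid (fun i => f i + g i).
Proof.
move=> [a [b [e [a0 E]]]] [a' [b' [e' [a0' E']]]].
exists (a + a'), (b + b'), (e + e'); split=> [|i]; first exact: addr_gt0.
rewrite E E'; have -> : \sum_j (b + b') ord0 j * p i ord0 j =
   (\sum_j b ord0 j * p i ord0 j) + (\sum_j b' ord0 j * p i ord0 j).
  by rewrite -big_split; apply: eq_bigr => j _; rewrite !mxE mulrDl.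
ring.
Qed.

Lemma paraboloidZ (c : R) f : 0 < c -> paraboloid f -> paraboloid (fun i => c * f i).
Proof.
move=> c0 [a [b [e [a0 E]]]]; exists (c * a), (c *: b), (c * e).
split=> [|i]; first exact: mulr_gt0.
rewrite E; have -> : \sum_j (c *: b) ord0 j * p i ord0 j =
    c * \sum_j b ord0 j * p i ord0 j.
  by rewrite mulr_sumr; apply: eq_bigr => j _; rewrite !mxE mulrA.
ring.
Qed.

Lemma paraboloid_sqdist z (s : R) : paraboloid (fun i => sqdist z (p i) - s).
Proof.
exists 1, (- 2 *: z), (\sum_j z ord0 j ^+ 2 - s); split=> [|i] //.
rewrite mul1r addrA; congr (_ - _); rewrite -!big_split; apply: eq_bigr => j _ /=.
rewrite !mxE; ring.
Qed.

Lemma paraboloid_center f : paraboloid f -> exists a c e, 0 < a /\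
  forall i, f i = a * sqdist c (p i) + e.
Proof.
move=> [a [b [e [a0 E]]]]; pose c := - (2 * a)^-1 *: b.
exists a, c, (e - a * \sum_j c ord0 j ^+ 2); split=> // i.
rewrite E -addrA addrCA addrC -addrA; apply/eqP; rewrite -subr_eq0; apply/eqP.
have -> : \sum_j b ord0 j * p i ord0 j =
    a * (sqdist c (p i) - \sum_j p i ord0 j ^+ 2 - \sum_j c ord0 j ^+ 2).
  rewrite -!sumrB mulr_sumr; apply: eq_bigr => j _; rewrite !mxE.
  by field; rewrite gt_eqF.
ring.
Qed.

Definition inball (s : R) Q := exists z, forall i, i \in Q -> sqdist z (p i) <= s.

Definition cech (s : R) : pred {set 'I_n} := fun Q => (Q != set0) && `[< inball s Q >].

(** By completing the square, [C] is the set of all cloud points on a sphere with no cloud point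
    inside: a Delaunay cell. The empty set is also a cell. *)
Definition cell C : bool := `[< exists f, [/\ paraboloid f, forall i, 0 <= f i
  & forall i, (i \in C) = (f i == 0)] >].

Lemma cellI C C' : cell C -> cell C' -> cell (C :&: C').
Proof.
move=> /asboolP[f [Pf f0 fC]] /asboolP[g [Pg g0 gC]]; apply/asboolP.
exists (fun i => f i + g i); split => [|i|i]; first exact: paraboloidD.
  exact: addr_ge0.
by rewrite inE fC gC paddr_eq0.
Qed.

(** The cloud points nearest to [c] are the zeros of the squared distance to [c] minus its minimum;
    conversely, the centre of a cell's paraboloid is nearest to the whole cell. *)
Lemma is_delE Q : is_del p Q = (Q != set0) && [exists C, cell C && (Q \subset C)].
Proof.
rewrite /is_del; have [//|/set0Pn[i0 i0Q] /=] := eqVneq Q set0.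
apply/asboolP/existsP => [[c Hc]|[C /andP[/asboolP[f [Pf f0 fC]] /subsetP QC]]].
  pose f i := sqdist c (p i) - sqdist c (p i0).
  exists [set i | f i == 0]; apply/andP; split.
    apply/asboolP; exists f; split=> [|i|i]; first exact: paraboloid_sqdist.
      by rewrite subr_ge0 -edist2_le Hc.
    by rewrite inE.
  apply/subsetP => i iQ; rewrite inE /f subr_eq0 eq_le -!edist2_le.
  by rewrite !Hc.
have [a [c [e [a0 E]]]] := paraboloid_center Pf.
exists c => i iQ j; rewrite edist2_le.
have := f0 j; have := QC i iQ; rewrite fC !E => /eqP h1 h2.
by rewrite -(ler_pM2l a0); lra.
Qed.

Lemma cech_face_closed s : face_closed (cech s).
Proof.
move=> Q Q' /andP[_ /asboolP[z zQ]] /subsetP sQ Q0.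
rewrite /cech Q0; apply/asboolP; exists z => i /sQ.
exact: zQ.
Qed.

Lemma inball_sub s Q Q' : Q \subset Q' -> inball s Q' -> inball s Q.
Proof. by move=> /subsetP sQ [z zQ]; exists z => i /sQ; apply: zQ. Qed.

(** Supplies the large multiples of a cell's paraboloid that raise values off the cell and change
    nothing on it. *)
Lemma bounded_ratio (I : finType) (P : pred I) (f g : I -> R) :
  (forall i, P i -> 0 < f i) -> exists2 M, 0 < M & forall i, P i -> g i <= M * f i.
Proof.
move=> f0; exists (1 + \sum_(i | P i) `|g i| / f i) => [|i Pi].
  rewrite ltr_pwDl // sumr_ge0 // => i Pi.
  by rewrite divr_ge0 // ltW ?f0.
have fi := f0 i Pi; rewrite -ler_pdivrMr //.
rewrite (bigD1 i) //= addrCA; apply: le_trans (_ : `|g i| / f i <= _).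
  by rewrite ler_pM2r ?invr_gt0 // ler_norm.
rewrite lerDl addr_ge0 // sumr_ge0 // => j /andP[Pj _].
by rewrite divr_ge0 // ltW ?f0.
Qed.

Definition under_cells s (SS : {set {set 'I_n}}) : pred {set 'I_n} := fun Q =>
  cech s Q && [exists C in SS, Q \subset C].

(** Here the cell itself must fit in a ball, not only the simplex. With all cells as [SS],
    [under_cells] is DelCech, and the present smaller complex is what the convexity argument
    yields. *)
Definition under_inball_cells s (SS : {set {set 'I_n}}) : pred {set 'I_n} := fun Q =>
  (Q != set0) && [exists C in SS, (Q \subset C) && `[< inball s C >]].

Definition subcells C : {set {set 'I_n}} := [set C' | cell C' && (C' \subset C)].

Lemma under_cells_face_closed s SS : face_closed (under_cells s SS).
Proof.
move=> Q Q' /andP[cQ /exists_inP[C CS QC]] sQ Q0; rewrite /under_cells.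
rewrite (cech_face_closed cQ sQ Q0) /=; apply/exists_inP; exists C => //.
exact: subset_trans QC.
Qed.

Lemma under_inball_cells_face_closed s SS : face_closed (under_inball_cells s SS).
Proof.
move=> Q Q' /andP[_ /exists_inP[C CS /andP[QC iC]]] sQ Q0; rewrite /under_inball_cells.
rewrite Q0 /=; apply/exists_inP; exists C => //; rewrite iC andbT.
exact: subset_trans QC.
Qed.

Lemma under_inball_cells_sub s SS :
  subpred (under_inball_cells s SS) (under_cells s SS).
Proof.
move=> Q /andP[Q0 /exists_inP[C CS /andP[QC /asboolP iC]]]; rewrite /under_cells /cech Q0.
apply/andP; split; first by apply/asboolP; apply: inball_sub iC.
by apply/exists_inP; exists C.
Qed.

(* The convex family consists of the paraboloids dominating some [|z - .|^2 - s] on [Y]: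
   nonpositivity on [Q] puts [Q] in a ball of squared radius [s], and nonnegativity on all
   of [Y] puts the whole zero set, a cell, in that ball. *)
Lemma cech_rel_acyclic s (Y : {set 'I_n}) :
  (forall f, paraboloid f -> (forall i, i \in Y -> 0 <= f i) ->
     cell [set i in Y | f i == 0]) ->
  rel_acyclic F (fun Q => cech s Q && (Q \subset Y)) (under_inball_cells s (subcells Y)).
Proof.
move=> cellY.
pose Theta f := paraboloid f /\ exists z, forall i, i \in Y -> sqdist z (p i) - s <= f i.
have conv f g (t : R) : 0 <= t <= 1 -> Theta f -> Theta g ->
    Theta (fun i => (1 - t) * f i + t * g i).
  move=> t01 [Pf [z zf]] [Pg [z' z'g]]; have /andP[t0 t1] := t01; split.
    (* Paraboloids admit only positive factors, so the endpoints are treated apart. *)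
    have [->|tn0] := eqVneq t 0.
      suff -> : (fun i => (1 - 0) * f i + 0 * g i) = f by [].
      by apply/funext => i; ring.
    have [->|tn1] := eqVneq t 1.
      suff -> : (fun i => (1 - 1) * f i + 1 * g i) = g by [].
      by apply/funext => i; ring.
    apply: paraboloidD; apply: paraboloidZ => //; last by rewrite lt_neqAle eq_sym tn0.
    by rewrite subr_gt0 lt_neqAle tn1.
  exists ((1 - t) *: z + t *: z') => i iY.
  have := sqdist_convex z z' (p i) t01; have := zf i iY; have := z'g i iY; nra.
have ge0 : exists2 f, Theta f & forall i, i \in Y -> 0 <= f i.
  (* The minimum makes the function nonnegative whatever the sign of [s], while it still dominates
     the power with centre 0. *)
  exists (fun i => sqdist 0 (p i) - Num.min s 0).
    split; first exact: paraboloid_sqdist.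
    by exists 0 => i _; rewrite lerD2l lerN2 ge_min lexx.
  move=> i _; rewrite subr_ge0 ge_min [X in _ || X](_ : _ = true) ?orbT //.
  by rewrite sumr_ge0 // => j _; rewrite sqr_ge0.
apply: eq_rel_acyclic (sublevel_rel_acyclic (F := F) conv ge0 (subxx Y)) => Q.
  rewrite /sublevel_cplx /cech -andbA; congr (_ && _); rewrite andbC.
  have [QY|_] := boolP (Q \subset Y); last by rewrite !andbF.
  rewrite !andbT; apply: asbool_equiv_eq; split=> [[f [[_ [z zf]] fQ _]]|[z zQ]].
    exists z => i iQ; have := zf i (subsetP QY i iQ); have := fQ i iQ; lra.
  exists (fun i => sqdist z (p i) - s); split=> [|i iQ|i]; last by rewrite inE.
    by split; [exact: paraboloid_sqdist | exists z].
  by rewrite subr_le0 zQ.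
rewrite /sublevel_cplx /under_inball_cells; congr (_ && _); apply/idP/idP.
  move=> /andP[/subsetP QY /asboolP[f [[Pf [z zf]] fQ f0]]].
  apply/exists_inP; exists [set i in Y | f i == 0].
    by rewrite inE cellY //=; apply/subsetP => i; rewrite inE => /andP[].
  apply/andP; split.
    apply/subsetP => i iQ; rewrite inE QY //= eq_le f0 ?QY // andbT; exact: fQ.
  apply/asboolP; exists z => i; rewrite inE => /andP[iY /eqP fi].
  by have := zf i iY; rewrite fi subr_le0.
move=> /exists_inP[C]; rewrite inE => /andP[cC CY] /andP[QC /asboolP[z zC]].
rewrite (subset_trans QC CY); apply/asboolP.
have /asboolP[g [Pg g0 gC]] := cC.
(* On [C] the power at [z] is nonpositive and [g] vanishes; off [C] a large multiple of [g]
   dominates that power. *)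
have [|M M0 HM] := @bounded_ratio _ (fun i => i \notin C) g (fun i => sqdist z (p i) - s).
  by move=> i; rewrite gC lt_neqAle eq_sym g0 andbT.
exists (fun i => M * g i); split=> [|i /(subsetP QC)|i _]; last 2 first.
- by rewrite gC => /eqP ->; rewrite mulr0.
- by rewrite mulr_ge0 ?(ltW M0).
split; first exact: paraboloidZ.
exists z => i iY; have [iC|] := boolP (i \in C); last exact: HM.
have := iC; rewrite gC => /eqP ->; rewrite mulr0 subr_le0; exact: zC.
Qed.

(** Adding to [f] a large multiple of the paraboloid of [C] makes it positive off [C]. Thus
    [cech_rel_acyclic] applies inside a single cell. *)
Lemma cell_zero_set C f : cell C -> paraboloid f -> (forall i, i \in C -> 0 <= f i) ->
  cell [set i in C | f i == 0].
Proof.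
move=> /asboolP[g [Pg g0 gC]] Pf f0.
have [|M M0 HM] := @bounded_ratio _ (fun i => i \notin C) g (fun i => 1 - f i).
  by move=> i; rewrite gC lt_neqAle eq_sym g0 andbT.
apply/asboolP; exists (fun i => M * g i + f i).
split=> [|i|i]; first by apply: paraboloidD => //; apply: paraboloidZ.
  have [iC|/HM] := boolP (i \in C); last lra.
  by have := f0 i iC; have := iC; rewrite gC => /eqP ->; rewrite mulr0 add0r.
rewrite inE; have [iC|/HM ?] := boolP (i \in C).
  by have := iC; rewrite gC => /eqP ->; rewrite mulr0 add0r.
by apply/esym/negbTE; rewrite gt_eqF //; lra.
Qed.

(** Induction on [#|SS|], removing a cell [C] of maximal cardinality so that the family stays closed
    under subcells. If [C] fits in a ball, both complexes lose the same simplices and excision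
    applies. Otherwise the smaller complex does not change, and the larger one keeps its homology by
    the convexity argument inside [C] and the induction hypothesis for its proper subcells. *)
Lemma under_cells_rel_acyclic s (SS : {set {set 'I_n}}) :
  (forall C, C \in SS -> cell C /\ subcells C \subset SS) ->
  rel_acyclic F (under_cells s SS) (under_inball_cells s SS).
Proof.
have [m] := ubnP #|SS|; elim: m SS => // m IH SS Sm HS.
have [S0|/set0Pn[C0 C0S]] := eqVneq SS set0.
  apply: eq_rel_acyclic (rel_acyclic_refl (A := under_cells s SS)) => // Q.
  rewrite /under_cells /under_inball_cells S0.
  by rewrite !(introF exists_inP) ?andbF // => -[C]; rewrite inE.
case: (arg_maxnP (fun C : {set 'I_n} => #|C|) C0S) => C CS Cmax.
have {}CS : C \in SS by [].
have [cC sC] := HS C CS.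
have HS' C' : C' \in SS :\ C -> cell C' /\ subcells C' \subset SS :\ C.
  rewrite in_setD1 => /andP[nC C'S]; have [cC' sC'] := HS _ C'S; split=> //.
  apply/subsetP => D DC'; rewrite in_setD1 (subsetP sC' D DC') andbT.
  apply: contra nC => /eqP DC; move: DC'; rewrite inE DC => /andP[_ CC'].
  by rewrite eq_sym eqEcard CC'; apply: Cmax.
(* A simplex lying in [C] and in a remaining cell thus lies in a remaining cell contained in [C]. *)
have meet C' : C' \in SS :\ C -> C :&: C' \in SS :\ C.
  move=> C'S; have [cC' /subsetP sC'] := HS' _ C'S; apply: sC'.
  by rewrite inE cellI // subsetIr.
have IHm : (#|SS :\ C| < m)%N by move: Sm; rewrite (cardsD1 C SS) CS.
have [iC|niC] := pselect (inball s C).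
  apply: rel_acyclic_excision (IH _ IHm HS');
    try exact: under_cells_face_closed; try exact: under_inball_cells_face_closed.
  move=> Q; rewrite /under_cells /under_inball_cells.
  have [cQ /=|ncQ //] := boolP (cech s Q).
  have /andP[-> _ /=] := cQ.
  apply/idP/idP => /andP[/exists_inP[C' C'S QC'] /exists_inP N].
    have nQC : ~~ (Q \subset C).
      by apply/negP => QC; apply: N; exists C => //; rewrite QC; apply/asboolP.
    have C'S' : C' \in SS :\ C.
      by rewrite in_setD1 C'S andbT; apply: contra nQC => /eqP <-.
    apply/andP; split; first by apply/exists_inP; exists C'.
    apply/exists_inP => -[D]; rewrite in_setD1 => /andP[_ DS] HD; apply: N.
    by exists D.
  move: (C'S); rewrite in_setD1 => /andP[_ C'SS].
  apply/andP; split; first by apply/exists_inP; exists C'.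
  apply/exists_inP => -[D DS /andP[QD iD]]; apply: N.
  have [DC|DC] := eqVneq D C; last by exists D; rewrite ?in_setD1 ?DC // QD.
  exists (C :&: C'); first exact: meet.
  rewrite subsetI QC' -{1}DC QD /=; apply/asboolP; apply: inball_sub iC; exact: subsetIl.
have ltS' : subcells C :\ C \subset SS :\ C by apply: setSD.
have subC' C' : C' \in subcells C :\ C -> cell C' /\ subcells C' \subset subcells C :\ C.
  move=> C'S; have [cC' sC'] := HS' _ (subsetP ltS' _ C'S); split=> //.
  apply/subsetP => D DC'; have := subsetP sC' D DC'; rewrite !in_setD1 => /andP[-> _] /=.
  move: C'S DC'; rewrite !inE => /and3P[_ _ C'C] /andP[-> DC'] /=.
  exact: subset_trans C'C.
(* As [C] does not fit in a ball, omitting it from its own subcells leaves the second complex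
   unchanged. *)
have R1 : rel_acyclic F (fun Q => cech s Q && (Q \subset C))
    (under_inball_cells s (subcells C :\ C)).
  have := @cech_rel_acyclic s C (fun f => cell_zero_set cC).
  apply: eq_rel_acyclic => // Q; congr (_ && _).
  apply/exists_inP/exists_inP => -[D DS HD]; exists D => //.
    rewrite in_setD1 DS andbT; apply/eqP => DC; apply: niC.
    by move: HD; rewrite DC => /andP[_ /asboolP].
  by move: DS; rewrite in_setD1 => /andP[].
have R2 : rel_acyclic F (under_cells s (subcells C :\ C))
    (under_inball_cells s (subcells C :\ C)).
  by apply: IH => //; apply: leq_ltn_trans IHm; apply: subset_leq_card.
have R3 : rel_acyclic F (fun Q => cech s Q && (Q \subset C))
    (under_cells s (subcells C :\ C)).
  apply: rel_acyclic_2of3 R1 R2.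
  - move=> Q /andP[-> /exists_inP[D]]; rewrite !inE => /and3P[_ _ DC] QD.
    exact: subset_trans DC.
  - exact: under_inball_cells_sub.
  - exact: under_cells_face_closed.
have R4 : rel_acyclic F (under_cells s SS) (under_cells s (SS :\ C)).
  apply: rel_acyclic_excision R3; try exact: under_cells_face_closed.
    move=> Q Q' /andP[cQ QC] sQ Q0; rewrite (cech_face_closed cQ sQ Q0) /=.
    exact: subset_trans QC.
  move=> Q; rewrite /under_cells; have [cQ /=|//] := boolP (cech s Q).
  apply/idP/idP => /andP[H1 /exists_inP N].
    have QC : Q \subset C.
      apply/negPn/negP => nQC; apply: N; case/exists_inP: H1 => D DS QD; exists D => //.
      by rewrite in_setD1 DS andbT; apply: contra nQC => /eqP <-.
    rewrite QC /=; apply/exists_inP => -[D DS QD]; apply: N; exists D => //.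
    exact: (subsetP ltS').
  apply/andP; split; first by apply/exists_inP; exists C.
  apply/exists_inP => -[D DS QD]; apply: N; exists (C :&: D); last by rewrite subsetI H1.
  have := meet D DS; rewrite !in_setD1 => /andP[-> DCS] /=.
  by rewrite inE subsetIl andbT; have [] := HS _ DCS.
apply: rel_acyclic_trans R4 _; last 1 first.
- apply: eq_rel_acyclic (IH _ IHm HS') => // Q; congr (_ && _).
  apply/exists_inP/exists_inP => -[D DS HD]; exists D => //.
    by move: DS; rewrite in_setD1 => /andP[].
  rewrite in_setD1 DS andbT; apply/eqP => DC; apply: niC.
  by move: HD; rewrite DC => /andP[_ /asboolP].
- move=> Q /andP[cQ /exists_inP[D]]; rewrite in_setD1 => /andP[_ DS] QD.
  by rewrite /under_cells cQ; apply/exists_inP; exists D.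
- move=> Q /andP[Q0 /exists_inP[D DS /andP[QD iD]]].
  rewrite /under_cells /cech Q0 /=; apply/andP; split.
    by apply/asboolP; apply: inball_sub QD _; apply/asboolP.
  apply/exists_inP; exists D => //; rewrite in_setD1 DS andbT; apply/eqP => DC.
  by apply: niC; rewrite -DC; apply/asboolP.
Qed.

Definition del_cech s : pred {set 'I_n} := fun Q => is_del p Q && cech s Q.

(** Both complexes are compared with the faces of the cells that fit in a ball. *)
Theorem cech_del_cech_rel_acyclic s : rel_acyclic F (cech s) (del_cech s).
Proof.
pose SS := subcells setT.
have R1 : rel_acyclic F (cech s) (under_inball_cells s SS).
  have cT f : paraboloid f -> (forall i, i \in [set: 'I_n] -> 0 <= f i) ->
      cell [set i in [set: 'I_n] | f i == 0].
    move=> Pf f0; apply/asboolP; exists f; split=> // i; first by rewrite f0 ?inE.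
    by rewrite !inE.
  apply: eq_rel_acyclic (cech_rel_acyclic (s := s) cT) => // Q.
  by rewrite subsetT andbT.
have R2 : rel_acyclic F (under_cells s SS) (under_inball_cells s SS).
  apply: under_cells_rel_acyclic => C; rewrite inE => /andP[cC _]; split=> //.
  by apply/subsetP => D; rewrite !inE => /andP[-> _]; rewrite subsetT.
apply: eq_rel_acyclic (rel_acyclic_2of3 _ _ _ R1 R2) => // [Q|Q|Q|].
- rewrite /under_cells /del_cech is_delE /cech.
  have [//|Q0] := eqVneq Q set0; rewrite /= andbC; congr (_ && _).
  apply/exists_inP/existsP => [[C CS QC]|[C /andP[cC QC]]]; exists C => //.
    by move: CS; rewrite inE => /andP[->].
  by rewrite inE cC subsetT.
- by case/andP.
- exact: under_inball_cells_sub.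
- exact: under_cells_face_closed.
Qed.

End Cells.
Arguments cech_del_cech_rel_acyclic F {R d n} p s _ _ _.

(** * Jung's theorem *)

Section Jung.
Variables (R : realType) (d n : nat) (p : 'I_n -> 'rV[R]_d).

Definition in_simplex (Q : {set 'I_n}) (l : 'I_n -> R) :=
  [/\ forall i, 0 <= l i, forall i, i \notin Q -> l i = 0 & \sum_i l i = 1].

(** A continuous function attains its maximum on the simplex, which is compact as a closed part of a
    box. *)
Lemma simplex_argmax (Q : {set 'I_n}) (D : 'I_n -> 'I_n -> R) : Q != set0 ->
  exists2 l, in_simplex Q l & forall l', in_simplex Q l' ->
    \sum_i l' i * \sum_j l' j * D i j <= \sum_i l i * \sum_j l j * D i j.
Proof.
move=> /set0Pn[i0 i0Q].
pose f (v : 'rV[R]_n) : R := \sum_i v ord0 i * \sum_j v ord0 j * D i j.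
pose g (v : 'rV[R]_n) : R := \sum_i v ord0 i.
have cc i : continuous (fun v : 'rV[R]_n => v ord0 i) by apply: coord_continuous.
have cg : continuous g by apply: continuous_big => [|i _]; [exact: add_continuous | exact: cc].
have cf : continuous f.
  apply: continuous_big => [|i _ v]; first exact: add_continuous.
  apply: (@continuousM R 'rV[R]_n (fun u : 'rV[R]_n => u ord0 i)
    (fun u : 'rV[R]_n => \sum_j u ord0 j * D i j) v).
    exact: cc.
  apply: continuous_big => [|j _ u].
    exact: add_continuous.
  apply: (@continuousM R 'rV[R]_n (fun w : 'rV[R]_n => w ord0 j) (fun=> D i j) u); first exact: cc.
  exact: cst_continuous.
pose A : set 'rV[R]_n := ([set v : 'rV[R]_n | forall i, (if i \in Q then `[0, 1]%classic else [set 0]%classic)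
   (v ord0 i)] `&` (g @^-1` [set x | x = 1]))%classic.
have cA : compact A.
  apply: compact_closedI.
    apply: (@rV_compact R n (fun i => if i \in Q then `[0, 1]%classic else [set 0]%classic)).
    move=> i; case: ifP => _; [exact: segment_compact | exact: compact_set1].
  apply: closed_comp; last exact: closed_eq.
  by move=> v _; apply: cg.
have AP v : A v <-> in_simplex Q (fun i => v ord0 i).
  split=> [[Av gv]|[v0 vQ v1]].
    split=> // i; have := Av i; case: ifP => iQ //=; last by move=> ->.
    by rewrite in_itv /= => /andP[].
  split=> // i /=; case: ifP => iQ /=; last by rewrite vQ ?iQ.
  rewrite in_itv /= v0 -v1 (bigD1 i) //= lerDl sumr_ge0 // => j _.
have [|v /set_mem Av mv] := EVT_max_rV _ cA (continuous_subspaceT cf).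
  exists (\row_i (i == i0)%:R); apply/AP; split=> [i|i iQ|].
  - by rewrite mxE ler0n.
  - by rewrite mxE; case: eqP iQ => // ->; rewrite i0Q.
  - by rewrite (bigD1 i0) //= big1 ?mxE ?eqxx ?addr0 // => i ni; rewrite mxE (negPf ni).
exists (fun i => v ord0 i); first exact/AP.
move=> l' sl'.
have -> : l' = fun i => (\row_j l' j) ord0 i by apply/funext => i; rewrite mxE.
apply: mv; apply/mem_set/AP.
suff -> : (fun i => (\row_j l' j) ord0 i) = l' by [].
by apply/funext => i; rewrite mxE.
Qed.

Let mean (l : 'I_n -> R) : 'rV[R]_d := \row_k \sum_j l j * p j ord0 k.

(** The parallel axis identity: the double sum is twice the weighted variance of the points. *)
Lemma sqdist_mean (l : 'I_n -> R) (y : 'rV[R]_d) : \sum_i l i = 1 ->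
  \sum_j l j * sqdist y (p j) = sqdist y (mean l) +
    2^-1 * \sum_i l i * \sum_j l j * sqdist (p i) (p j).
Proof.
move=> l1; pose m2 k := \sum_j l j * p j ord0 k ^+ 2.
have S (y' : 'rV[R]_d) : \sum_j l j * sqdist y' (p j) =
    \sum_k (y' ord0 k ^+ 2 - 2 * y' ord0 k * mean l ord0 k + m2 k).
  transitivity (\sum_k \sum_j l j * (y' ord0 k - p j ord0 k) ^+ 2).
    by rewrite exchange_big; apply: eq_bigr => j _; rewrite mulr_sumr.
  apply: eq_bigr => k _; rewrite mxE /m2 mulr_sumr -[y' ord0 k ^+ 2]mul1r -{1}l1.
  rewrite mulr_suml -sumrB -big_split; apply: eq_bigr => j _ /=; ring.
have -> : \sum_i l i * \sum_j l j * sqdist (p i) (p j) =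
    \sum_k (2 * m2 k - 2 * mean l ord0 k ^+ 2).
  transitivity (\sum_k \sum_i l i *
      (p i ord0 k ^+ 2 - 2 * p i ord0 k * mean l ord0 k + m2 k)).
    by rewrite exchange_big; apply: eq_bigr => i _; rewrite S mulr_sumr.
  apply: eq_bigr => k _.
  transitivity (m2 k - 2 * mean l ord0 k * (\sum_i l i * p i ord0 k) + (\sum_i l i) * m2 k).
    by rewrite {1 2}/m2 mulr_sumr mulr_suml -sumrB -big_split; apply: eq_bigr => i _ /=; rewrite /m2; ring.
  by rewrite l1 mxE; ring.
by rewrite S mulr_sumr -big_split; apply: eq_bigr => k _ /=; lra.
Qed.

(** Weights [l] maximizing the mean squared distance [f] satisfy [G i <= f] on [Q], so by
    [sqdist_mean] every point of [Q] is within squared distance [f / 2] of the weighted mean. The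
    diagonal terms of [f] vanish, and the squares of the weights sum to at least [#|Q|^-1], which
    bounds [f]. *)
Theorem jung (Q : {set 'I_n}) (D : R) : Q != set0 ->
  (forall i j, i \in Q -> j \in Q -> sqdist (p i) (p j) <= D) ->
  inball p (2^-1 * D * (1 - #|Q|%:R^-1)) Q.
Proof.
move=> Q0 QD; have [l [l0 lQ l1] lmax] := simplex_argmax (fun i j => sqdist (p i) (p j)) Q0.
pose G i := \sum_j l j * sqdist (p i) (p j).
pose f := \sum_i l i * G i.
have Gf i : i \in Q -> G i <= f.
  move=> iQ.
  (* Maximality of [l] against the weights moved by [t] towards the vertex [i], divided by [t]. *)
  have key (t : R) : 0 < t <= 1 -> 2 * (1 - t) * G i <= (2 - t) * f.
    move=> /andP[t0 t1]; pose l' j := (1 - t) * l j + t * (j == i)%:R.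
    have sl' (h : 'I_n -> R) : \sum_j l' j * h j = (1 - t) * (\sum_j l j * h j) + t * h i.
      rewrite mulr_sumr; have -> : t * h i = \sum_j t * (j == i)%:R * h j.
        rewrite (bigD1 i) //= eqxx mulr1 big1 ?addr0 // => j /negPf ->.
        by rewrite mulr0 mul0r.
      by rewrite -big_split; apply: eq_bigr => j _ /=; rewrite /l'; ring.
    have := lmax l'; rewrite -/f sl'.
    under eq_bigr do rewrite sl'.
    rewrite sl'.
    have -> : \sum_j l j * ((1 - t) * (\sum_j0 l j0 * sqdist (p j) (p j0)) + t * sqdist (p j) (p i)) =
        (1 - t) * f + t * G i.
      rewrite !mulr_sumr -big_split; apply: eq_bigr => j _ /=.
      have -> : sqdist (p j) (p i) = sqdist (p i) (p j).
        by apply: eq_bigr => k _; rewrite -sqrrN opprB.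
      by rewrite -/(G j); ring.
    have -> : sqdist (p i) (p i) = 0 by apply: big1 => k _; rewrite subrr expr0n.
    rewrite -/(G i) => H; rewrite -(ler_pM2l t0).
    have : (1 - t) * ((1 - t) * f + t * G i) + t * ((1 - t) * G i + t * 0) <= f.
      apply: H; split=> [j|j jQ|].
      - by rewrite addr_ge0 ?mulr_ge0 ?subr_ge0 ?(ltW t0) ?ler0n.
      - rewrite /l' lQ // (_ : (j == i) = false) ?mulr0 ?addr0 //.
        by apply/negbTE; apply: contraNneq jQ => ->.
      - by have := sl' (fun=> 1); rewrite !(eq_bigr _ (fun j _ => mulr1 _)) l1 => ->; ring.
    lra.
  have G0 : 0 <= G i by apply: sumr_ge0 => j _; rewrite mulr_ge0 // sumr_ge0 // => k _; exact: sqr_ge0.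
  rewrite leNgt; apply/negP => fG.
  (* An explicit small [t] contradicting [key], in place of a limit at 0. *)
  pose t := (G i - f) / (2 * G i + (G i - f)).
  have t01 : 0 < t <= 1.
    by rewrite divr_gt0 /= ?ler_pdivrMr; lra.
  have := key t t01.
  have tE : t * (2 * G i + (G i - f)) = G i - f by rewrite /t divfK //; lra.
  have /andP[t0 _] := t01; nra.
have fD : f <= D * (1 - #|Q|%:R^-1).
  have m0 : 0 < #|Q|%:R :> R by rewrite ltr0n card_gt0.
  have D0 : 0 <= D.
    have /set0Pn[i iQ] := Q0; apply: le_trans (QD i i iQ iQ).
    by apply: sumr_ge0 => k _; exact: sqr_ge0.
  apply: (@le_trans _ _ (\sum_i D * (l i - l i ^+ 2))).
    apply: ler_sum => i _; have [iQ|/lQ ->] := boolP (i \in Q); last by rewrite mul0r expr0n subrr mulr0.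
    have -> : D * (l i - l i ^+ 2) = l i * (D * (1 - l i)) by ring.
    apply: ler_wpM2l => //.
    have -> : D * (1 - l i) = \sum_(j | j != i) l j * D.
      by rewrite -l1 (bigD1 i) //= addrAC subrr add0r mulrC mulr_suml.
    rewrite /G (bigD1 i) //= (_ : sqdist (p i) (p i) = 0) ?mulr0 ?add0r; last first.
      by apply: big1 => k _; rewrite subrr expr0n.
    apply: ler_sum => j _; have [jQ|/lQ ->] := boolP (j \in Q); last by rewrite !mul0r.
    by rewrite ler_wpM2l // QD.
  rewrite -mulr_sumr sumrB l1 ler_wpM2l // lerD2l lerN2.
  have : 0 <= \sum_(i in Q) (l i - #|Q|%:R^-1) ^+ 2 by apply: sumr_ge0 => i _; exact: sqr_ge0.
  have lQ1 : \sum_(i in Q) l i = 1.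
    by rewrite -l1 [RHS](bigID (mem Q)) /= [X in _ = _ + X]big1 ?addr0 // => i /lQ.
  have lQ2 : \sum_(i in Q) l i ^+ 2 = \sum_i l i ^+ 2.
    rewrite [RHS](bigID (mem Q)) /= [X in _ = _ + X]big1 ?addr0 // => i /lQ ->.
    by rewrite expr0n.
  have -> : \sum_(i in Q) (l i - #|Q|%:R^-1) ^+ 2 =
      \sum_i l i ^+ 2 - 2 * #|Q|%:R^-1 * \sum_(i in Q) l i + \sum_(i in Q) #|Q|%:R^-1 ^+ 2.
    by rewrite -lQ2 mulr_sumr -sumrB -big_split; apply: eq_bigr => i _ /=; ring.
  have -> : \sum_(i in Q) #|Q|%:R^-1 ^+ 2 = #|Q|%:R^-1 :> R.
    by rewrite sumr_const -[_ *+ _]mulr_natl expr2 mulVKf // gt_eqF.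
  rewrite lQ1; lra.
exists (mean l) => i iQ; have := sqdist_mean (p i) l1; rewrite -/(G i) -/f.
have -> : sqdist (mean l) (p i) = sqdist (p i) (mean l).
  by apply: eq_bigr => k _; rewrite -sqrrN opprB.
have := Gf i iQ; lra.
Qed.

End Jung.

(** * The interleaving *)

Section GradedChains.
Variables (F : fieldType) (n : nat).
Implicit Types (c z w : chain F n) (A B K L : pred {set 'I_n}) (k : nat).

Lemma mem_chainsp K k c :
  c \in chainsp F K k <-> supported (fun t => K t && (#|t| == k.+1)) c.
Proof.
rewrite /chainsp; set X := [seq _ | _ <- _]; split=> [cX t nt|sc].
  rewrite (coord_span (X := in_tuple X) cX) sum_ffunE big1 // => i _; rewrite ffunE.
  have : (in_tuple X)`_i \in X by rewrite mem_nth.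
  case/mapP => s; rewrite mem_enum inE => Ks ->.
  rewrite ffunE; case: eqP => [ts|_]; last by rewrite scaler0.
  by move: nt; rewrite ts Ks.
have -> : c = \sum_(s | K s && (#|s| == k.+1)) c s *: chi F s.
  apply/ffunP => t; rewrite sum_ffunE.
  have [Kt|nKt] := boolP (K t && (#|t| == k.+1)).
    rewrite (bigD1 t) //= big1 => [|s /andP[_ st]]; rewrite !ffunE.
      by rewrite eqxx addr0 [RHS]mulr1.
    by rewrite eq_sym (negPf st) scaler0.
  rewrite sc // big1 // => s Ks; rewrite !ffunE; case: eqP => [ts|_].
    by move: nKt; rewrite ts Ks.
  by rewrite scaler0.
apply: memv_suml => s Ks; apply: memvZ; apply: memv_span; apply/mapP.
by exists s => //; rewrite mem_enum.
Qed.

Lemma mem_cycles K k c :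
  c \in cycles F K k <-> c \in chainsp F K k /\ bnd_fun c = 0.
Proof.
rewrite /cycles memv_cap memv_ker bndE.
by split=> [/andP[-> /eqP]|[-> ->]] //=; rewrite eqxx.
Qed.

Lemma mem_bdries K k c :
  c \in bdries F K k <-> exists2 w, w \in chainsp F K k.+1 & c = bnd_fun w.
Proof.
split=> [/memv_imgP[w wK ->]|[w wK ->]]; first by exists w; rewrite ?bndE.
by rewrite -bndE memv_img.
Qed.

Lemma chainspS K L k : (forall t : {set 'I_n}, #|t| = k.+1 -> K t -> L t) ->
  (chainsp F K k <= chainsp F L k)%VS.
Proof.
move=> KL; apply/subvP => c /mem_chainsp sc; apply/mem_chainsp; apply: sub_supported sc.
by move=> t /andP[Kt /eqP tk]; rewrite KL //= tk.
Qed.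

Lemma cyclesS K L k : (forall t : {set 'I_n}, #|t| = k.+1 -> K t -> L t) ->
  (cycles F K k <= cycles F L k)%VS.
Proof. by move=> KL; apply: capvS (chainspS KL) (subvv _). Qed.

Lemma bdriesS K L k : (forall t : {set 'I_n}, #|t| = k.+2 -> K t -> L t) ->
  (bdries F K k <= bdries F L k)%VS.
Proof. by move=> KL; rewrite limgS // chainspS. Qed.

(** The boundary lowers cardinality by one, so only the part of the correcting chain of cardinality
    [k.+2] matters. *)
Lemma rel_acyclic_graded A B k z : rel_acyclic F A B ->
  z \in chainsp F A k -> supported B (bnd_fun z) ->
  exists2 w, w \in chainsp F A k.+1 & z - bnd_fun w \in chainsp F B k.
Proof.
move=> rAB /mem_chainsp sz sdz.
have [|w0 sw0 szw] := rAB z _ sdz.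
  by apply: sub_supported sz => t /andP[].
pose w := restr (fun t => #|t| == k.+2) w0.
exists w; apply/mem_chainsp => t nt.
  by rewrite ffunE; case: ifP => // tk; rewrite sw0 //; rewrite tk andbT in nt.
have [tk|tk] := boolP (#|t| == k.+1).
  suff -> : (z - bnd_fun w) t = (z - bnd_fun w0) t by apply: szw; rewrite tk andbT in nt.
  rewrite !ffunE; congr (_ - _); case: eqP => // _; apply: eq_bigr => v vt.
  by rewrite ffunE cardsU1 vt (eqP tk) eqxx.
rewrite !ffunE sz ?(negPf tk) ?andbF // sub0r; case: eqP => [_|_]; first by rewrite oppr0.
by rewrite big1 ?oppr0 // => v vt; rewrite ffunE cardsU1 vt add1n eqSS (negPf tk) mulr0.
Qed.

(** Surjectivity in homology of the inclusion of [B] in [A]. *)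
Lemma rel_acyclic_cycles A B k : rel_acyclic F A B ->
  (cycles F A k <= cycles F B k + bdries F A k)%VS.
Proof.
move=> rAB; apply/subvP => z /mem_cycles[zA dz].
have [|w wA zw] := rel_acyclic_graded rAB zA; first by rewrite dz; apply: supported0.
rewrite -[z](subrK (bnd_fun w)) memv_add //; last by apply/mem_bdries; exists w.
by apply/mem_cycles; split=> //; rewrite linearB /= dz bnd_fun_comp subr0.
Qed.

(** Injectivity in homology: a filling in [A] of a cycle of [B] is itself a relative cycle, one
    degree higher. *)
Lemma rel_acyclic_bdries A B k : rel_acyclic F A B ->
  (cycles F B k :&: bdries F A k <= bdries F B k)%VS.
Proof.
move=> rAB; apply/subvP => z; rewrite memv_cap => /andP[/mem_cycles[/mem_chainsp zB dz]].
case/mem_bdries=> w wA zw.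
have [|u uA wu] := rel_acyclic_graded rAB wA.
  by rewrite -zw; apply: sub_supported zB => t /andP[].
apply/mem_bdries; exists (w - bnd_fun u) => //.
by rewrite linearB /= bnd_fun_comp subr0.
Qed.

End GradedChains.

(** * Comparison of scales and the interleaving maps *)

Section Interleaving.
Variables (R : realType) (F : fieldType) (d n : nat) (p : 'I_n -> 'rV[R]_d) (k : nat).
Local Notation c := (cconst R k.+1).

Lemma diam_leP (M : R) (Q : {set 'I_n}) : 0 <= M ->
  reflect (forall i j, i \in Q -> j \in Q -> sqdist (p i) (p j) <= M ^+ 2) (diam p Q <= M).
Proof.
move=> M0.
have eP i j : (edist2 (p i) (p j) <= M) = (sqdist (p i) (p j) <= M ^+ 2).
  by rewrite -{1}[M]ger0_norm // -sqrtr_sqr ler_sqrt // sqr_ge0.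
rewrite /diam; apply: (iffP (bigmax_leP _ _ _ _)) => [[_ H] i j iQ jQ|H].
  by have /(bigmax_leP _ _ _ _)[_ H'] := H i iQ; rewrite -eP; apply: H'.
split=> // i iQ; apply/(bigmax_leP _ _ _ _); split=> // j jQ; rewrite eP; exact: H.
Qed.

Lemma cconst_sqr m : cconst R m ^+ 2 = 2 * m%:R / m.+1%:R.
Proof. by rewrite sqr_sqrtr // divr_ge0 // mulr_ge0. Qed.

Lemma cconst_ge1 : 1 <= c.
Proof.
rewrite -[X in X <= _]sqrtr1 ler_sqrt ?divr_ge0 ?mulr_ge0 //.
by rewrite ler_pdivlMr ?ltr0n // mul1r -natrM ler_nat; lia.
Qed.

Lemma cconst_mul_ge (r : R) : 0 <= r -> r <= c * r.
Proof. by move=> r0; rewrite ler_peMl // cconst_ge1. Qed.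

Lemma cconst_mul_ge0 (r : R) : 0 <= r -> 0 <= c * r.
Proof. by move=> r0; apply: le_trans (cconst_mul_ge r0). Qed.

(** Jung's bound for diameter [2 * r], where [c ^+ 2 = 2 * (1 - k.+2%:R^-1)]. At most [k.+2]
    vertices suffice, since degree [k] homology involves simplices of dimension at most [k.+1]. *)
Lemma rips_cech (r : R) (Q : {set 'I_n}) : 0 <= r -> (#|Q| <= k.+2)%N ->
  rips p r Q -> cech p ((c * r) ^+ 2) Q.
Proof.
move=> r0 Qk /andP[Q0 /diam_leP-/(_ (mulr_ge0 (ler0n _ 2) r0)) QD].
rewrite /rips_cplx in Q0; rewrite /cech Q0; apply/asboolP; have [z zQ] := jung Q0 QD.
exists z => i /zQ /le_trans; apply; rewrite !exprMn cconst_sqr.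
have Qpos : 0 < #|Q|%:R :> R by rewrite ltr0n card_gt0.
have kpos : 0 < k.+2%:R :> R by rewrite ltr0n.
have -> : 2 * k.+1%:R / k.+2%:R = 2 * (1 - k.+2%:R^-1) :> R.
  rewrite -[k.+2%:R]natr1 in kpos *; set m : R := k.+1%:R in kpos *.
  by field; rewrite gt_eqF.
have : k.+2%:R^-1 <= #|Q|%:R^-1 :> R by rewrite lef_pV2 // ler_nat.
move=> /(ler_wpM2l (sqr_ge0 r)).
move: (k.+2%:R^-1 : R) (#|Q|%:R^-1 : R) => x y; lra.
Qed.

Lemma cech_rips (r : R) (Q : {set 'I_n}) : 0 <= r -> cech p (r ^+ 2) Q -> rips p r Q.
Proof.
move=> r0 /andP[Q0 /asboolP[z zQ]]; rewrite /rips /filt /rips_cplx Q0 /=.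
apply/diam_leP => [|i j iQ jQ]; first by rewrite mulr_ge0.
have : sqdist (p i) (p j) <= 2 * (sqdist z (p i) + sqdist z (p j)).
  rewrite -big_split mulr_sumr ler_sum // => l _ /=.
  have := sqr_ge0 (z ord0 l - p i ord0 l + (z ord0 l - p j ord0 l)); nra.
have := zQ i iQ; have := zQ j jQ; nra.
Qed.

Lemma del_cech_drips (r : R) (Q : {set 'I_n}) : 0 <= r ->
  del_cech p (r ^+ 2) Q -> drips p r Q.
Proof. by move=> r0 /andP[dQ /(cech_rips r0)/andP[_ Qr]]; apply/andP. Qed.

Lemma drips_rips (r : R) (Q : {set 'I_n}) : drips p r Q -> rips p r Q.
Proof. by move=> /andP[/andP[Q0 _] Qr]; apply/andP. Qed.

Lemma drips_del_cech (r : R) (Q : {set 'I_n}) : 0 <= r -> (#|Q| <= k.+2)%N ->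
  drips p r Q -> del_cech p ((c * r) ^+ 2) Q.
Proof.
move=> r0 Qk Qr; rewrite /del_cech rips_cech ?drips_rips // andbT.
by case/andP: Qr.
Qed.

Lemma filtS (K : pred {set 'I_n}) (r r' : R) Q : r <= r' -> filt p K r Q -> filt p K r' Q.
Proof. by move=> rr' /andP[KQ Qr]; rewrite /filt KQ (le_trans Qr) // ler_wpM2l. Qed.

Lemma cechS (s s' : R) Q : s <= s' -> cech p s Q -> cech p s' Q.
Proof.
move=> ss' /andP[Q0 /asboolP[z zQ]]; rewrite /cech Q0; apply/asboolP; exists z => i /zQ.
by move/le_trans; apply.
Qed.

Lemma del_cechS (s s' : R) Q : s <= s' -> del_cech p s Q -> del_cech p s' Q.
Proof. by move=> ss' /andP[dQ cQ]; rewrite /del_cech dQ (cechS ss'). Qed.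

(** This inclusion and the next are the inputs of [diagram_matching] that involve the factor [c]. *)
Lemma rips_cycles_sub (r : R) : 0 <= r ->
  (cycles F (rips p r) k <= cycles F (drips p (c * r)) k + bdries F (rips p (c * r)) k)%VS.
Proof.
move=> r0; have cr0 := cconst_mul_ge0 r0.
apply: (@subv_trans _ _ (cycles F (cech p ((c * r) ^+ 2)) k)).
  by apply: cyclesS => t tk; apply: rips_cech; rewrite // tk.
have H := rel_acyclic_cycles k (cech_del_cech_rel_acyclic F p ((c * r) ^+ 2)).
apply: (subv_trans H).
by apply: addvS; [apply: cyclesS | apply: bdriesS] => t _; [exact: del_cech_drips | exact: cech_rips].
Qed.

Lemma drips_rips_bdries_sub (r : R) : 0 <= r ->
  (cycles F (drips p r) k :&: bdries F (rips p r) k <= bdries F (drips p (c * r)) k)%VS.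
Proof.
move=> r0; have cr0 := cconst_mul_ge0 r0.
apply: (@subv_trans _ _ (bdries F (del_cech p ((c * r) ^+ 2)) k)).
  have H := rel_acyclic_bdries k (cech_del_cech_rel_acyclic F p ((c * r) ^+ 2)).
  apply: subv_trans H.
  apply: capvS; [apply: cyclesS | apply: bdriesS] => t tk.
    by apply: drips_del_cech; rewrite // tk.
  by apply: rips_cech; rewrite // tk.
by apply: bdriesS => t _; exact: del_cech_drips.
Qed.

(** [Psi] is the inclusion. [Phi] writes a Rips cycle as a DelCech cycle plus a Cech boundary and
    keeps the first summand; [addv_pi1] makes the choice linearly. *)
Theorem rips_drips_interleaved : mult_strongly_interleaved F (rips p) (drips p) k c.
Proof.
have c1 := cconst_ge1; split=> //.
pose s r := (c * r) ^+ 2.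
pose Zd r := cycles F (del_cech p (s r)) k; pose Bc r := bdries F (cech p (s r)) k.
pose Bd r := bdries F (del_cech p (s r)) k.
pose Phi r := addv_pi1 (Zd r) (Bc r).
have rel r := cech_del_cech_rel_acyclic F p (s r).
have sS r r' : 0 <= r -> r <= r' -> s r <= s r'.
  move=> r0 rr'; rewrite /s lerXn2r ?nnegrE ?cconst_mul_ge0 ?(le_trans r0) //.
  by rewrite ler_wpM2l ?(le_trans _ c1).
have ZP r z : 0 <= r -> z \in cycles F (rips p r) k -> z \in (Zd r + Bc r)%VS.
  move=> r0 zr; apply: (subvP (rel_acyclic_cycles k (rel r))).
  by apply: subvP zr; apply: cyclesS => t tk; apply: rips_cech; rewrite // tk.
have PhiZ r z : Phi r z \in Zd r by exact: memv_pi1.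
have PhiB r z : z \in (Zd r + Bc r)%VS -> Phi r z - z \in Bc r.
  move=> zs; rewrite -[X in _ - X](addv_pi1_pi2 zs) opprD addrA subrr sub0r.
  by rewrite memvN memv_pi2.
(* Two choices of the DelCech cycle differ by a Cech boundary, hence by a DelCech boundary: [Phi] is
   well defined in homology. *)
have BcBd r r' z : 0 <= r -> r <= r' -> z \in Zd r -> z \in Bc r -> z \in Bd r'.
  move=> r0 rr' zZ zB; have : z \in Bd r.
    by apply: (subvP (rel_acyclic_bdries k (rel r))); rewrite memv_cap zZ.
  by apply: subvP; apply: bdriesS => t _; apply: del_cechS; apply: sS.
have Bd_drips r : 0 <= r -> (Bd r <= bdries F (drips p (c * r)) k)%VS.
  by move=> r0; apply: bdriesS => t _; apply: del_cech_drips; apply: cconst_mul_ge0.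
have Bc_rips r : 0 <= r -> (Bc r <= bdries F (rips p (c * r)) k)%VS.
  by move=> r0; apply: bdriesS => t _; apply: cech_rips; apply: cconst_mul_ge0.
have ZdS r r' : 0 <= r -> r <= r' -> (Zd r <= Zd r')%VS.
  by move=> r0 rr'; apply: cyclesS => t _; apply: del_cechS; apply: sS.
have BcS r r' : 0 <= r -> r <= r' -> (Bc r <= Bc r')%VS.
  by move=> r0 rr'; apply: bdriesS => t _; apply: cechS; apply: sS.
have drips_Zd r : 0 <= r -> (cycles F (drips p r) k <= Zd r)%VS.
  by move=> r0; apply: cyclesS => t tk; apply: drips_del_cech; rewrite // tk.
exists Phi, (fun=> \1%VF); split; last split; last split; last split; last split.
- move=> r r0; apply/andP; split; apply/subvP => _ /memv_imgP[z zr ->].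
    apply: subvP (PhiZ r z); apply: cyclesS => t _; apply: del_cech_drips.
    exact: cconst_mul_ge0.
  have zB : z \in Bc r.
    by apply: subvP zr; apply: bdriesS => t tk; apply: rips_cech; rewrite // tk.
  apply: (subvP (Bd_drips r r0)); apply: (BcBd r) => //.
  rewrite -[Phi r z](subrK z) memvD // PhiB //.
  by rewrite -[z]add0r memv_add // mem0v.
- move=> r r0; have rcr := cconst_mul_ge r0; apply/andP; split; apply/subvP => _ /memv_imgP[z zr ->].
    rewrite id_lfunE; apply: subvP zr; apply: cyclesS => t _ /drips_rips.
    exact: filtS.
  rewrite id_lfunE; apply: subvP zr; apply: bdriesS => t _ /drips_rips; exact: filtS.
- move=> r r0 z zr; rewrite comp_lfunE !id_lfunE.
  apply: subvP (PhiB r z (ZP r z r0 zr)); apply: (subv_trans (Bc_rips r r0)).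
  apply: bdriesS => t _; apply: filtS; rewrite expr2 -mulrA cconst_mul_ge //.
  exact: cconst_mul_ge0.
- move=> r r0 z zr; rewrite comp_lfunE !id_lfunE.
  have rcr := cconst_mul_ge r0; have cr0 := cconst_mul_ge0 r0.
  have zZ : z \in Zd (c * r) by apply: (subvP (ZdS r _ r0 rcr)); apply: (subvP (drips_Zd r r0)).
  rewrite expr2 -mulrA; apply: (subvP (Bd_drips _ cr0)); apply: (BcBd (c * r)) => //.
    by rewrite memvB.
  by apply: PhiB; rewrite -[z]addr0 memv_add // mem0v.
- move=> r r' r0 rr' z zr; have r'0 := le_trans r0 rr'.
  apply: (subvP (Bd_drips r' r'0)); apply: (BcBd r') => //.
    by rewrite memvB // (subvP (ZdS r r' r0 rr')).
  have zs := ZP r z r0 zr.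
  rewrite -[X in _ - X](subrK z) opprD addrA addrAC memvB //.
    apply: PhiB; apply: subvP zs; apply: addvS; [exact: ZdS | exact: BcS].
  by apply: (subvP (BcS r r' r0 rr')); apply: PhiB.
- by move=> r r' r0 rr' z _; rewrite subrr mem0v.
Qed.

End Interleaving.

(** * Matching bars *)

Section KeyMatching.
Local Open Scope nat_scope.
Variables (T : Type) (K : eqType) (x0 : T) (key : T -> K) (le : rel T).
Hypotheses (le_tr : transitive le) (le_tot : total le).

(** Positions rather than elements are sorted, because a diagram may repeat a point. *)
Definition key_class (A : seq T) (a : K) : seq nat :=
  sort (fun i j => le (nth x0 A i) (nth x0 A j))
    [seq i <- iota 0 (size A) | key (nth x0 A i) == a].

Lemma mem_key_class A a i : (i \in key_class A a) = (i < size A) && (key (nth x0 A i) == a).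
Proof. by rewrite mem_sort mem_filter mem_iota andbC. Qed.

Lemma key_class_uniq A a : uniq (key_class A a).
Proof. by rewrite sort_uniq filter_uniq ?iota_uniq. Qed.

Lemma count_key_class A a (P : pred T) :
  count (fun i => P (nth x0 A i)) (key_class A a) = count (fun x => (key x == a) && P x) A.
Proof.
rewrite /key_class (permP (permEl (perm_sort _ _))) count_filter.
rewrite -[A in RHS](mkseq_nth x0) /mkseq count_map.
by apply: eq_count => i /=; rewrite andbC.
Qed.

Lemma key_class_sorted A a :
  sorted (fun i j => le (nth x0 A i) (nth x0 A j)) (key_class A a).
Proof. by apply: sort_sorted => i j; apply: le_tot. Qed.

(** The elements satisfying the downward closed [P] form an initial segment of the sorted class. *)
Lemma key_class_nth A a (P : pred T) m : (forall x y, le x y -> P y -> P x) ->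
  m < count (fun x => (key x == a) && P x) A ->
  m < size (key_class A a) /\ P (nth x0 A (nth 0 (key_class A a) m)).
Proof.
move=> Pd; rewrite -count_key_class => mc.
have := key_class_sorted A a.
elim: (key_class A a) m mc => // i s IH m /= mc srt.
have iall : all (fun j => le (nth x0 A i) (nth x0 A j)) s.
  by apply: order_path_min srt => j k l; apply: le_tr.
have [Pi|nPi] := boolP (P (nth x0 A i)); last first.
  move: mc; rewrite (negPf nPi) (eqP (_ : count _ s == 0)) //.
  rewrite -leqn0 leqNgt -has_count; apply: contra nPi => /hasP[j js Pj].
  by apply: Pd Pj; apply: (allP iall).
move: mc; rewrite Pi; case: m => [|m] //; rewrite add1n !ltnS => mc.
by apply: IH => //; apply: path_sorted srt.
Qed.

Lemma key_class_rank A i (a := key (nth x0 A i)) : i < size A ->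
  index i (key_class A a) <
    count (fun y => (key y == a) && le y (nth x0 A i)) A.
Proof.
move=> iA; rewrite -count_key_class.
have := key_class_sorted A a.
have : i \in key_class A a by rewrite mem_key_class iA eqxx.
elim: (key_class A a) => // j s IH.
rewrite inE /= [j == i]eq_sym; have [ij _ _|ij /= ins js] := eqVneq i j.
  by rewrite ij; have := le_tot (nth x0 A j) (nth x0 A j); rewrite orbb => ->.
have jall : all (fun l => le (nth x0 A j) (nth x0 A l)) s.
  by apply: order_path_min js => l1 l2 l3; apply: le_tr.
have := allP jall i ins => /= ->; rewrite add1n ltnS.
by apply: IH ins (path_sorted js).
Qed.

(** Within each key, the element of rank [m] in [A] goes to that of rank [m] in [B]. The first count
    inequality makes this possible and gives [P1]; the second, read from [B] back to [A], gives [P2]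
    and shows that only short elements are missed. *)
Theorem key_matching (A B : seq T) (P1 P2 : T -> T -> bool) (short : pred T) :
  (forall x y y', le y' y -> P1 x y -> P1 x y') ->
  (forall x x' y, le x' x -> P2 x y -> P2 x' y) ->
  (forall i, i < size A -> let x := nth x0 A i in
     count (fun y => (key y == key x) && le y x) A <=
     count (fun y => (key y == key x) && P1 x y) B) ->
  (forall j, j < size B -> let y := nth x0 B j in ~~ short y ->
     count (fun y' => (key y' == key y) && le y' y) B <=
     count (fun x => (key x == key y) && P2 x y) A) ->
  exists s : nat -> nat,
   [/\ forall i j, i < size A -> j < size A -> s i = s j -> i = j,
       forall i, i < size A -> let x := nth x0 A i in let y := nth x0 B (s i) in
         [/\ s i < size B, key y = key x, P1 x y & short y || P2 x y] &
       forall j, j < size B -> j \notin [seq s i | i <- iota 0 (size A)] ->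
         short (nth x0 B j)].
Proof.
move=> P1d P2d H1 H2.
pose ka i := key (nth x0 A i).
pose rk i := index i (key_class A (ka i)).
pose s i := nth 0 (key_class B (ka i)) (rk i).
have fwd i : i < size A -> rk i < size (key_class B (ka i)) /\ P1 (nth x0 A i) (nth x0 B (s i)).
  move=> iA; apply: key_class_nth; first by move=> y y'; apply: P1d.
  by apply: leq_trans (H1 i iA); apply: key_class_rank.
have sB i : i < size A -> s i \in key_class B (ka i).
  by move=> /fwd[ri _]; apply: mem_nth.
have iK i : i < size A -> i \in key_class A (ka i) by move=> iA; rewrite mem_key_class iA eqxx.
have bwd j (b := key (nth x0 B j)) (m := index j (key_class B b)) : j < size B ->
    ~~ short (nth x0 B j) -> m < size (key_class A b) /\
      P2 (nth x0 A (nth 0 (key_class A b) m)) (nth x0 B j).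
  move=> jB nsh; apply: (key_class_nth (P := fun x => P2 x (nth x0 B j))).
    by move=> x x'; apply: P2d.
  by apply: leq_trans (H2 j jB nsh); apply: key_class_rank.
exists s; split.
- move=> i j iA jA sij; have := sB i iA; have := sB j jA.
  rewrite sij !mem_key_class => /andP[_ /eqP e1] /andP[_ /eqP e2].
  have kij : ka i = ka j by rewrite -e1 -e2.
  move: sij; rewrite /s kij => /eqP.
  have [ri _] := fwd i iA; have [rj _] := fwd j jA.
  rewrite kij in ri; rewrite nth_uniq ?key_class_uniq // => /eqP; rewrite /rk kij => rij.
  by rewrite -[i](nth_index 0 (iK i iA)) kij rij nth_index // iK.
- move=> i iA /=; have [ri P1i] := fwd i iA.
  have := sB i iA; rewrite mem_key_class => /andP[siB /eqP ksi]; split=> //.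
  have [//|nsh] := boolP (short _).
  have [_] := bwd (s i) siB nsh.
  by rewrite ksi /s index_uniq ?key_class_uniq // nth_index // iK.
- move=> j jB; apply: contraNT => nsh; have [mA _] := bwd j jB nsh.
  set b := key _ in mA *; set m := index _ _ in mA.
  pose i := nth 0 (key_class A b) m.
  have : i \in key_class A b by rewrite mem_nth.
  rewrite mem_key_class => /andP[iA /eqP kib].
  apply/mapP; exists i; first by rewrite mem_iota.
  rewrite /s /rk /ka kib index_uniq ?key_class_uniq // nth_index //.
  by rewrite mem_key_class jB eqxx.
Qed.

End KeyMatching.

(** * Persistence points of a pair of cycle and boundary filtrations *)

Section PersistencePoints.
Variables (R : realType) (F : fieldType) (vT : vectType F).
Implicit Types (U V W : {vspace vT}) (t w : seq R) (Z B : R -> {vspace vT}).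

(** The two mixed intersections lie in [U' :&: W'] and meet in [U :&: W]. This makes the
    multiplicities below nonnegative. *)
Lemma dimv_cap_supermodular U U' W W' : (U <= U')%VS -> (W <= W')%VS ->
  (\dim (U' :&: W) + \dim (U :&: W') <= \dim (U' :&: W') + \dim (U :&: W))%N.
Proof.
move=> UU' WW'; rewrite -dimv_sum_cap leq_add // dimvS //.
  by rewrite subv_add !capvS.
by rewrite subv_cap (subv_trans (capvSr _ _) (capvSl _ _)) (subv_trans (capvSl _ _) (capvSr _ _)).
Qed.

(* Value of the step function [Z], with jumps at [t], on the [i]-th step; it is [0] before
   the first jump. *)
Definition step_value t Z (i : nat) : {vspace vT} :=
  if i is i'.+1 then Z (nth 0 t i') else 0%VS.

Definition step_filtration t Z := [/\ sorted <%R t,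
  {homo Z : a b / a <= b >-> (a <= b)%VS} &
  forall r, Z r = step_value t Z (count (<= r) t)].

(** The additional last value [fullv] makes every remaining class die, at time [+oo]. *)
Definition death_value w B (j : nat) : {vspace vT} :=
  if j is j'.+1 then (if (j' < size w)%N then B (nth 0 w j') else fullv) else 0%VS.

Definition death_time w (j : nat) : \bar R :=
  if (j < size w)%N then (nth 0 w j)%:E else +oo%E.

(** The number of classes born at step [i] and dying at step [j], as a mixed second difference of
    [\dim (Z :&: B)]. *)
Definition pts_mult t Z w B (i j : nat) : nat :=
  ((\dim (step_value t Z i.+1 :&: death_value w B j.+1) -
    \dim (step_value t Z i :&: death_value w B j.+1)) -
   (\dim (step_value t Z i.+1 :&: death_value w B j) -
    \dim (step_value t Z i :&: death_value w B j)))%N.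

(** Births and deaths have separate time lists, as required for the image bars, where [Z] and [B]
    come from different complexes. *)
Definition pts t Z w B : seq (R * \bar R) :=
  flatten [seq nseq (pts_mult t Z w B i j) (nth 0 t i, death_time w j)
    | i <- iota 0 (size t),
      j <- [seq j <- iota 0 (size w).+1 | ((nth 0 t i)%:E < death_time w j)%E]].

Lemma count_pts t Z w B (P : pred (R * \bar R)) :
  count P (pts t Z w B) =
  (\sum_(0 <= i < size t) \sum_(0 <= j < (size w).+1 |
      ((nth 0%R t i)%:E < death_time w j)%E)
    P (nth 0%R t i, death_time w j) * pts_mult t Z w B i j)%N.
Proof.
rewrite count_flatten sumnE big_map big_allpairs_dep /index_iota subn0.
apply: eq_bigr => i _; rewrite big_filter subn0; apply: eq_bigr => j _.
by rewrite count_nseq.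
Qed.

Lemma mem_pts t Z w B x : x \in pts t Z w B ->
  [/\ x.1 \in t, exists2 j, (j <= size w)%N & x.2 = death_time w j & (x.1%:E < x.2)%E].
Proof.
move=> /flattenP[s /allpairsPdep[i [j [it jw ->]]]] /nseqP[-> _] /=.
move: it jw; rewrite mem_filter !mem_iota /= !add0n ltnS => it /andP[tw jw].
by split=> //; [rewrite mem_nth | exists j].
Qed.

Section Counting.
Variables (t w : seq R) (Z B : R -> {vspace vT}).
Hypotheses (tZ : step_filtration t Z) (wB : step_filtration w B).

Lemma step_valueS i j : (i <= j <= size t)%N -> (step_value t Z i <= step_value t Z j)%VS.
Proof.
have [ts Zm _] := tZ; case: i => [|i]; first by rewrite sub0v.
case: j => // j /andP[ij jt]; apply: Zm; apply: sorted_leq_nth => //.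
- exact: le_trans.
- by apply: sub_sorted ts => x y /ltW.
- by rewrite inE; apply: leq_trans jt.
Qed.

Lemma death_valueS j : (death_value w B j <= death_value w B j.+1)%VS.
Proof.
have [ws Bm _] := wB; case: j => [|j]; first by rewrite sub0v.
rewrite /death_value; case: ifP => jw; last by rewrite (ltnNge j.+1) ltnW // ltnNge jw.
case: ifP => j1w; last exact: subvf.
apply: Bm; apply: sorted_leq_nth => //; [exact: le_trans|].
by apply: sub_sorted ws => x y /ltW.
Qed.

Lemma death_value_le i j : (i <= j)%N -> (death_value w B i <= death_value w B j)%VS.
Proof.
move=> /subnKC <-; elim: (j - i)%N => [|m IH]; first by rewrite addn0.
by rewrite addnS (subv_trans IH) // death_valueS.
Qed.

Lemma death_time_gt (b : R) j : (j <= size w)%N ->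
  (b%:E < death_time w j)%E = (count (<= b) w <= j)%N.
Proof.
have [ws _ _] := wB; have ws' : sorted <=%R w by apply: sub_sorted ws => x y /ltW.
move=> jw; rewrite /death_time; case: ifP => jw'; last first.
  by rewrite ltry (leq_trans (count_size _ _)) // leqNgt jw'.
rewrite lte_fin; apply/idP/idP => [bw|cj]; last by apply: nth_count_gt => //; rewrite cj.
by rewrite leqNgt; apply/negP => /(nth_count_le 0 ws'); rewrite leNgt bw.
Qed.

Lemma death_value_count (b : R) : death_value w B (count (<= b) w) = B b.
Proof.
have [_ _ Bs] := wB; rewrite [RHS]Bs; move: (count_size (<= b) w); case: (count _ w) => //= j jw.
by rewrite jw.
Qed.

Lemma death_time_inj i j : (i <= size w)%N -> (j <= size w)%N ->
  death_time w i = death_time w j -> i = j.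
Proof.
have [ws _ _] := wB; rewrite /death_time => iw jw.
case: ifP => iw'; case: ifP => jw'; [|by []|by []|lia].
by case=> /eqP; rewrite nth_uniq ?(lt_sorted_uniq ws) // => /eqP.
Qed.

Lemma pts_multC i j : (i < size t)%N -> pts_mult t Z w B i j =
  ((\dim (step_value t Z i.+1 :&: death_value w B j.+1) -
    \dim (step_value t Z i.+1 :&: death_value w B j)) -
   (\dim (step_value t Z i :&: death_value w B j.+1) -
    \dim (step_value t Z i :&: death_value w B j)))%N.
Proof.
move=> it; have sZ : (step_value t Z i <= step_value t Z i.+1)%VS by rewrite step_valueS // leqnSn.
have := dimv_cap_supermodular sZ (death_valueS j).
have := dimvS (capvS sZ (subvv (death_value w B j))).
have := dimvS (capvS sZ (subvv (death_value w B j.+1))).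
have := dimvS (capvS (subvv (step_value t Z i)) (death_valueS j)).
have := dimvS (capvS (subvv (step_value t Z i.+1)) (death_valueS j)).
rewrite /pts_mult; lia.
Qed.

(** The sum over the deaths after [b] telescopes. [step_value t Z (index a t)] is the value of [Z]
    just before [a]. *)
Lemma count_pts_birth (a b : R) : a \in t -> a <= b ->
  (count (fun x => (x.1 == a) && (b%:E < x.2)%E) (pts t Z w B) +
   (\dim (Z a :&: B b) - \dim (step_value t Z (index a t) :&: B b)) =
   \dim (Z a) - \dim (step_value t Z (index a t)))%N.
Proof.
have [ts _ _] := tZ; move=> at_ ab; set i0 := index a t.
have i0t : (i0 < size t)%N by rewrite index_mem.
have ti0 : nth 0 t i0 = a by rewrite nth_index.
rewrite count_pts (bigD1_seq i0) ?iota_uniq ?mem_index_iota //= [X in (_ + X + _)%N]big1_seq ?addn0; last first.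
  move=> i /andP[ii0]; rewrite mem_index_iota /= => it; rewrite big1 // => j _.
  by rewrite -ti0 nth_uniq ?(lt_sorted_uniq ts) // (negPf ii0).
set jb := count (<= b) w; have jbw : (jb <= size w)%N by exact: count_size.
pose g j := (\dim (step_value t Z i0.+1 :&: death_value w B j) -
             \dim (step_value t Z i0 :&: death_value w B j))%N.
have sZ : (step_value t Z i0 <= step_value t Z i0.+1)%VS by rewrite step_valueS // leqnSn.
have gS j : (g j <= g j.+1)%N.
  have := dimv_cap_supermodular sZ (death_valueS j).
  have := dimvS (capvS sZ (subvv (death_value w B j))).
  by have := dimvS (capvS sZ (subvv (death_value w B j.+1))); rewrite /g; lia.
transitivity ((\sum_(jb <= j < (size w).+1) (g j.+1 - g j)) + g jb)%N.
  congr addn; last by rewrite /g death_value_count /= ti0.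
  rewrite (big_nat_widenl jb 0) // [RHS]big_mkcond /= [LHS]big_mkcond.
  apply: eq_big_nat => j /= jw; rewrite ti0 eqxx /= !death_time_gt -/jb //.
  case: ifP => [|nt]; first by case: ifP; rewrite ?mul1n ?mul0n.
  case: ifP => // jbj; move: nt; rewrite (leq_trans _ jbj) //.
  by apply: sub_count => x /= /le_trans; apply.
rewrite (telescope_sumn_in (f := g)) ?leqW // subnK; last first.
  by apply: (homo_leq leqnn leq_trans gS); rewrite leqW.
by rewrite /g /= ltnn !capvf ti0.
Qed.

(** The sum over the births telescopes down to the zero space; such births automatically precede the
    death. *)
Lemma count_pts_death (a : R) j : (j <= size w)%N -> (a%:E < death_time w j)%E ->
  count (fun x => (x.1 <= a) && (x.2 == death_time w j)) (pts t Z w B) =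
  (\dim (Z a :&: death_value w B j.+1) - \dim (Z a :&: death_value w B j))%N.
Proof.
have [ts Zm Zs] := tZ; have ts' : sorted <=%R t by apply: sub_sorted ts => x y /ltW.
move=> jw aj; set ia := count (<= a) t; have iat : (ia <= size t)%N by exact: count_size.
pose h i := (\dim (step_value t Z i :&: death_value w B j.+1) -
             \dim (step_value t Z i :&: death_value w B j))%N.
have hS i : (i < ia)%N -> (h i <= h i.+1)%N.
  move=> ii; have it := leq_trans ii iat.
  have sZ : (step_value t Z i <= step_value t Z i.+1)%VS by rewrite step_valueS // leqnSn.
  have := dimv_cap_supermodular sZ (death_valueS j).
  have := dimvS (capvS (subvv (step_value t Z i)) (death_valueS j)).
  by have := dimvS (capvS (subvv (step_value t Z i.+1)) (death_valueS j)); rewrite /h; lia.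
rewrite count_pts; transitivity (\sum_(0 <= i < ia) (h i.+1 - h i))%N.
  rewrite (big_nat_widen 0 ia (size t)) // [RHS]big_mkcond; apply: eq_big_nat => i /= it.
  have -> : (i < ia)%N = (nth 0 t i <= a).
    apply/idP/idP => [ii|ta]; first exact: nth_count_le.
    rewrite ltnNge; apply/negP => ii.
    by have := nth_count_gt 0 ts' (x := a) (i := i); rewrite ii it => /(_ isT); rewrite ltNge ta.
  case: ifP => ta; last by rewrite big1.
  rewrite big_mkcond (bigD1_seq j) ?iota_uniq ?mem_index_iota //= big1_seq ?addn0.
    by rewrite eqxx mul1n pts_multC // (le_lt_trans _ aj) // lee_fin.
  move=> l /andP[lj]; rewrite mem_index_iota /= ltnS => lw; case: ifP => // _.
  by case: eqP => [/death_time_inj|]; rewrite ?mul0n // => /(_ lw jw) E; rewrite E eqxx in lj.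
rewrite (telescope_sumn_in (f := h)) //.
by rewrite /h Zs !cap0v dimv0 !subn0.
Qed.

End Counting.
End PersistencePoints.

(** * Comparison of bar counts and the matching of bars *)

Section MatchingPoints.
Variables (R : realType) (F : fieldType) (vT : vectType F).
Implicit Types (t w : seq R) (Z B : R -> {vspace vT}).

(** What is dead in [B2] at [b2] is dead in [B1] at [b1]; by supermodularity this also holds for
    dimensions relative to the value of [Z] before [a]. *)
Lemma count_pts_birth_le t Z w1 B1 w2 B2 (a b1 b2 : R) :
  step_filtration t Z -> step_filtration w1 B1 -> step_filtration w2 B2 ->
  a \in t -> a <= b1 -> a <= b2 -> (Z a :&: B2 b2 <= B1 b1)%VS ->
  (count (fun x => (x.1 == a) && (b1%:E < x.2)%E) (pts t Z w1 B1) <=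
   count (fun x => (x.1 == a) && (b2%:E < x.2)%E) (pts t Z w2 B2))%N.
Proof.
move=> tZ wB1 wB2 at_ ab1 ab2 sB.
have E1 := count_pts_birth tZ wB1 at_ ab1; have E2 := count_pts_birth tZ wB2 at_ ab2.
have sZ : (step_value t Z (index a t) <= Z a)%VS.
  rewrite -[in X in (_ <= X)%VS](nth_index 0 at_).
  by apply: (step_valueS tZ (j := (index a t).+1)); rewrite leqnSn index_mem.
have sB' : (Z a :&: B2 b2 <= Z a :&: B1 b1)%VS by rewrite subv_cap capvSl.
have := dimv_cap_supermodular sZ sB'; rewrite !capvA capvv.
rewrite [(step_value _ _ _ :&: Z a)%VS](capv_idPl sZ).
have := dimvS (capvS sZ (subvv (B1 b1))); have := dimvS (capvS sZ (subvv (B2 b2))).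
move: E1 E2; lia.
Qed.

(** Both counts are dimensions of [(Z :&: W + V) / V], and [B r] lies in [V] because [r] precedes
    the death [e]. *)
Lemma count_pts_death_le t1 Z1 t2 Z2 w B (a1 a2 r : R) (e : \bar R) :
  step_filtration t1 Z1 -> step_filtration t2 Z2 -> step_filtration w B ->
  (exists2 j, (j <= size w)%N & e = death_time w j) ->
  (a1%:E < e)%E -> (a2%:E < e)%E -> (r%:E < e)%E -> (Z1 a1 <= Z2 a2 + B r)%VS ->
  (count (fun x => (x.1 <= a1)%R && (x.2 == e)) (pts t1 Z1 w B) <=
   count (fun x => (x.1 <= a2)%R && (x.2 == e)) (pts t2 Z2 w B))%N.
Proof.
move=> tZ1 tZ2 wB [j jw ->] a1e a2e re sZ.
rewrite (count_pts_death tZ1 wB) // (count_pts_death tZ2 wB) //.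
set W := death_value w B j.+1; set V := death_value w B j.
have VW : (V <= W)%VS by apply: death_valueS.
have BV : (B r <= V)%VS.
  rewrite -(death_value_count wB r) /V.
  by apply: (death_value_le wB); rewrite -(death_time_gt wB).
have dimZ (Z : {vspace vT}) : \dim ((Z :&: W) + V)%VS = (\dim (Z :&: W) + \dim V - \dim (Z :&: V))%N.
  by rewrite -dimv_sum_cap -capvA (capv_idPr VW) addnK.
have : (\dim (Z1 a1 :&: W + V) <= \dim (Z2 a2 :&: W + V))%N.
  apply: dimvS; rewrite subv_add addvSr andbT; apply/subvP => z.
  rewrite memv_cap => /andP[/(subvP sZ)/memv_addP[x xZ [y yB ->]] zW].
  have yV : y \in V by apply: (subvP BV).
  rewrite memv_add // memv_cap xZ /= -[x](addrK y) memvB //.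
  exact: (subvP VW).
rewrite !dimZ; have := dimvS (capvSr (Z1 a1) V); have := dimvS (capvSr (Z2 a2) V).
have := dimvS (capvS (subvv (Z1 a1)) VW); have := dimvS (capvS (subvv (Z2 a2)) VW).
lia.
Qed.

(** Bars are counted by strictly late deaths, whereas the matching compares deaths non-strictly;
    among finitely many values [u], [u > b] implies [c * u >= e]. *)
Lemma threshold (s : seq (\bar R)) (a c : R) (e : \bar R) : 0 < c -> ((c * a)%:E < e)%E ->
  exists b, [/\ a <= b, ((c * b)%:E < e)%E &
    forall u, u \in s -> (c%:E * u < e)%E -> (u <= b%:E)%E].
Proof.
move=> c0 ae; elim: s => [|u s [b [ab be H]]]; first by exists a.
have [ue|nue] := boolP (c%:E * u < e)%E; last first.
  exists b; split=> // v; rewrite inE => /orP[/eqP ->|/H//]; by rewrite (negPf nue).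
case: u ue => [r| |] ue.
- exists (Num.max b r); split=> [||v]; first by rewrite le_max ab.
    by case: (leP b r) => _; rewrite // EFinM.
  rewrite inE EFin_max le_max => /orP[/eqP ->|/H{}H /H ->] //.
  by rewrite lexx orbT.
- by move: ue; rewrite gt0_muley ?lte_fin // ltNge leey.
- exists b; split=> // v; rewrite inE => /orP[/eqP -> _|/H//]; exact: leNye.
Qed.

Lemma leq_count_in (T : eqType) (P Q : pred T) (s : seq T) :
  {in s, subpred P Q} -> (count P s <= count Q s)%N.
Proof.
elim: s => //= x s IH H; apply: leq_add; last by apply: IH => y ys; apply: H; rewrite inE ys orbT.
by have := H x (mem_head x s); case: (P x) => // ->.
Qed.

Section Matching.
Variables (c : R) (tV tW : seq R) (ZV BV ZW BW : R -> {vspace vT}).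
Hypotheses (c1 : 1 <= c)
  (sZV : step_filtration tV ZV) (sBV : step_filtration tV BV)
  (sZW : step_filtration tW ZW) (sBW : step_filtration tW BW)
  (tV0 : forall a, a \in tV -> 0 <= a) (tW0 : forall a, a \in tW -> 0 <= a)
  (ZVW : forall a, (ZV a <= ZW a)%VS) (BVW : forall b, (BV b <= BW b)%VS)
  (ZWV : forall a, 0 <= a -> (ZW a <= ZV (c * a) + BW (c * a))%VS)
  (BWV : forall b, 0 <= b -> (ZV b :&: BW b <= BV (c * b))%VS).

Local Notation DI := (pts tV ZV tW BW).

Let c0 : 0 < c. Proof. exact: lt_le_trans c1. Qed.

(** These bars are so near the diagonal on the logarithmic scale that they may stay unmatched. *)
Definition short_bar (x : R * \bar R) := (x.2 <= (c * x.1)%:E)%E.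

Let x0 : R * \bar R := (0, 0%E).

(** With equal births, bars are ranked by decreasing death. [BVW] makes deaths in [D] no earlier,
    and [BWV] delays them by a factor of at most [c], short bars aside. *)
Lemma matching_same_birth (D : seq (R * \bar R)) : perm_eq D (pts tV ZV tV BV) ->
  exists s : nat -> nat,
   [/\ forall i j, (i < size DI)%N -> (j < size DI)%N -> s i = s j -> i = j,
       forall i, (i < size DI)%N -> let x := nth x0 DI i in let y := nth x0 D (s i) in
         [/\ (s i < size D)%N, y.1 = x.1, (x.2 <= y.2)%E &
           short_bar y || (y.2 <= c%:E * x.2)%E] &
       forall j, (j < size D)%N -> j \notin [seq s i | i <- iota 0 (size DI)] ->
         short_bar (nth x0 D j)].
Proof.
move=> pD.
apply: (@key_matching _ _ x0 fst (fun x y => (y.2 <= x.2)%E) _ _ DI D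
  (fun x y => (x.2 <= y.2)%E) (fun x y => (y.2 <= c%:E * x.2)%E) short_bar).
- by move=> y x z /= xy yz; apply: le_trans yz xy.
- by move=> x y /=; rewrite le_total.
- by move=> x y y' /= yy' xy; apply: le_trans xy yy'.
- move=> x x' y /= xx' yx; apply: le_trans yx _.
  by rewrite lee_wpmul2l // lee_fin ltW.
- move=> i iD; set x := nth _ _ _; have xD : x \in DI by rewrite mem_nth.
  have [xt _ xlt] := mem_pts xD.
  have [|b [ab bx Hb]] := @threshold [seq y.2 | y <- D] x.1 1 x.2 ltr01.
    by rewrite mul1r.
  rewrite mul1r in bx.
  apply: (@leq_trans (count (fun y => (y.1 == x.1) && (b%:E < y.2)%E) DI)).
    by apply: sub_count => y /= /andP[-> /(lt_le_trans bx) ->].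
  apply: leq_trans (count_pts_birth_le sZV sBW sBV xt ab ab _) _.
    exact: subv_trans (capvSr _ _) (BVW b).
  rewrite -(permP pD) leq_count_in // => y yD /andP[-> by2] /=.
  rewrite leNgt; apply/negP => yx; have := Hb y.2; rewrite mul1e => /(_ (map_f _ yD) yx).
  by rewrite leNgt by2.
- move=> j jD; set y := nth _ _ _; rewrite /short_bar -ltNge => ysh.
  have yD : y \in D by rewrite mem_nth.
  have [yt _ _] := mem_pts (etrans (esym (perm_mem pD y)) yD).
  have [b [ab cb Hb]] := @threshold [seq x.2 | x <- DI] y.1 c y.2 c0 ysh.
  have y0 := tV0 yt; have b0 : 0 <= b := le_trans y0 ab.
  have bcb : b <= c * b by rewrite ler_peMl.
  apply: (@leq_trans (count (fun y' => (y'.1 == y.1) && ((c * b)%:E < y'.2)%E) D)).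
    by apply: sub_count => y' /= /andP[-> /(lt_le_trans cb) ->].
  rewrite (permP pD); apply: leq_trans (count_pts_birth_le (w2 := tW) (B2 := BW) (b2 := b) sZV sBV sBW yt _ ab _) _.
  + exact: le_trans bcb.
  + by apply: subv_trans (BWV b0); apply: capvS => //; case: sZV => _ Zm _; apply: Zm.
  rewrite leq_count_in // => x xD /andP[-> bx] /=.
  rewrite leNgt; apply/negP => /(Hb x.2 (map_f _ xD)).
  by rewrite leNgt bx.
Qed.

(** With equal deaths, bars are ranked by increasing birth. [ZVW] makes births in [D] no later; by
    [ZWV] they are earlier by a factor of at most [c], short bars aside. *)
Lemma matching_same_death (D : seq (R * \bar R)) : perm_eq D (pts tW ZW tW BW) ->
  exists s : nat -> nat,
   [/\ forall i j, (i < size DI)%N -> (j < size DI)%N -> s i = s j -> i = j,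
       forall i, (i < size DI)%N -> let x := nth x0 DI i in let y := nth x0 D (s i) in
         [/\ (s i < size D)%N, y.2 = x.2, y.1 <= x.1 & short_bar y || (x.1 <= c * y.1)] &
       forall j, (j < size D)%N -> j \notin [seq s i | i <- iota 0 (size DI)] ->
         short_bar (nth x0 D j)].
Proof.
move=> pD.
apply: (@key_matching _ _ x0 snd (fun x y => x.1 <= y.1) _ _ DI D
  (fun x y => y.1 <= x.1) (fun x y => x.1 <= c * y.1) short_bar).
- by move=> y x z /= xy yz; apply: le_trans xy yz.
- by move=> x y /=; rewrite le_total.
- by move=> x y y' /= yy' xy; apply: le_trans yy' xy.
- by move=> x x' y /= xx' yx; apply: le_trans xx' yx.
- move=> i iD; set x := nth _ _ _; have xD : x \in DI by rewrite mem_nth.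
  have [xt xw xlt] := mem_pts xD.
  have := count_pts_death_le sZV sZW sBW xw xlt xlt xlt (subv_trans (ZVW _) (addvSl _ _)).
  rewrite -(permP pD); under eq_count do rewrite andbC.
  by under [X in (_ <= X)%N]eq_count do rewrite andbC.
- move=> j jD; set y := nth _ _ _; rewrite /short_bar -ltNge => ysh.
  have yD : y \in D by rewrite mem_nth.
  have [yt yw ylt] := mem_pts (etrans (esym (perm_mem pD y)) yD).
  have := count_pts_death_le sZW sZV sBW yw ylt ysh ysh (ZWV (tW0 yt)).
  rewrite -(permP pD); under eq_count do rewrite andbC.
  by under [X in (_ <= X)%N]eq_count do rewrite andbC.
Qed.

Theorem diagram_matching (D1 D2 : seq (R * \bar R)) :
  perm_eq D1 (pts tV ZV tV BV) -> perm_eq D2 (pts tW ZW tW BW) ->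
  exists m : seq (nat * nat),
   [/\ uniq (unzip1 m), uniq (unzip2 m),
       forall ij, ij \in m -> [/\ (ij.1 < size D1)%N, (ij.2 < size D2)%N &
         let x := nth x0 D1 ij.1 in let y := nth x0 D2 ij.2 in
         [/\ y.1 <= x.1, x.1 <= c * y.1, (y.2 <= x.2)%E & (x.2 <= c%:E * y.2)%E]],
       forall i, (i < size D1)%N -> i \notin unzip1 m -> short_bar (nth x0 D1 i) &
       forall j, (j < size D2)%N -> j \notin unzip2 m -> short_bar (nth x0 D2 j)].
Proof.
move=> p1 p2; have [s [sI sP sS]] := matching_same_birth p1.
have [u [uI uP uS]] := matching_same_death p2.
exists [seq (s i, u i) | i <- iota 0 (size DI)].
have e1 : unzip1 [seq (s i, u i) | i <- iota 0 (size DI)] = [seq s i | i <- iota 0 (size DI)].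
  by rewrite /unzip1 -map_comp.
have e2 : unzip2 [seq (s i, u i) | i <- iota 0 (size DI)] = [seq u i | i <- iota 0 (size DI)].
  by rewrite /unzip2 -map_comp.
rewrite e1 e2; split=> //.
- rewrite map_inj_in_uniq ?iota_uniq // => i j; rewrite !mem_iota /= => *; exact: sI.
- rewrite map_inj_in_uniq ?iota_uniq // => i j; rewrite !mem_iota /= => *; exact: uI.
move=> ij /mapP[i]; rewrite mem_iota /= => iD ->.
have [si b1 d1 l1] := sP i iD; have [ui d2 b2 l2] := uP i iD; split=> //=.
have [_ _ xlt] := mem_pts (mem_nth x0 iD).
rewrite b1 d2; split=> //.
  (* A short partner satisfies the bound too: [c] times its birth is at least the common death,
     which exceeds [x.1]. *)
  case/orP: l2 => //; rewrite /short_bar d2 => /(lt_le_trans xlt).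
  by rewrite lte_fin => /ltW.
case/orP: l1 => //; rewrite /short_bar b1 => /le_trans; apply.
by rewrite EFinM lee_wpmul2l ?lee_fin ?(ltW c0) // ltW.
Qed.

End Matching.
End MatchingPoints.

(** * Persistence diagrams of the two filtrations *)

Section DiagramPoints.
Variables (R : realType) (F : fieldType) (d n : nat) (p : 'I_n -> 'rV[R]_d).
Variables (K : pred {set 'I_n}) (k : nat).

Local Notation t := (crit p K).

Lemma crit_sorted : sorted <%R t.
Proof. by rewrite /crit sort_lt_sorted undup_uniq. Qed.

Lemma mem_crit s : K s -> diam p s / 2 \in t.
Proof. by move=> Ks; rewrite mem_sort mem_undup; apply: map_f; rewrite mem_enum. Qed.

Lemma crit_ge0 a : a \in t -> 0 <= a.
Proof.
rewrite mem_sort mem_undup => /mapP[s _ ->]; rewrite divr_ge0 //.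
exact: bigmax_ge_id.
Qed.

Lemma filt_crit r : filt p K r =
  if count (<= r) t is i.+1 then filt p K (nth 0 t i) else pred0.
Proof.
have tle : sorted <=%R t by apply: sub_sorted crit_sorted => x y /ltW.
have filtE s a : K s -> filt p K a s = (diam p s / 2 <= a).
  by move=> Ks; rewrite /filt Ks /= mulrC ler_pdivrMr.
apply/funext => s; have [Ks|nKs] := boolP (K s); last first.
  by case: (count _ _) => [|i]; rewrite /filt (negPf nKs).
rewrite filtE //; have := mem_crit Ks; set v := diam p s / 2 => vt.
case Ec : (count _ _) => [|i].
  apply/negbTE/negP => vr; have : has (<= r) t by apply/hasP; exists v.
  by rewrite has_count Ec.
rewrite filtE // -/v; apply/idP/idP => [vr|].
  have vi : (index v t < i.+1)%N.
    rewrite -Ec ltnNge; apply/negP => ic.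
    have := @nth_count_gt _ _ r 0 t (index v t) tle; rewrite ic index_mem vt => /(_ isT).
    by rewrite nth_index // ltNge vr.
  rewrite -[v](nth_index 0 vt); apply: sorted_leq_nth => //; first exact: le_trans.
    by rewrite inE index_mem.
  by rewrite inE -Ec count_size.
by move=> /le_trans; apply; apply: nth_count_le => //; rewrite Ec.
Qed.

Lemma step_filtration_filt (S : pred {set 'I_n} -> {vspace chain F n}) :
  (forall L L', subpred L L' -> (S L <= S L')%VS) -> S pred0 = 0%VS ->
  step_filtration t (fun r => S (filt p K r)).
Proof.
move=> SS S0; split; first exact: crit_sorted.
  by move=> a b ab; apply: SS => Q; apply: filtS.
by move=> r; rewrite filt_crit; case: count.
Qed.

Lemma chainsp0 j : chainsp F (pred0 : pred {set 'I_n}) j = 0%VS.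
Proof.
apply/eqP; rewrite -subv0; apply/subvP => c /mem_chainsp sc; rewrite memv0.
by apply/eqP/ffunP => s; rewrite sc // ffunE.
Qed.

Lemma step_cycles : step_filtration t (fun r => cycles F (filt p K r) k).
Proof.
apply: (step_filtration_filt (S := fun L => cycles F L k)) => [L L' LL'|].
  by apply: cyclesS => s _; apply: LL'.
by rewrite /cycles chainsp0 cap0v.
Qed.

Lemma step_bdries : step_filtration t (fun r => bdries F (filt p K r) k).
Proof.
apply: (step_filtration_filt (S := fun L => bdries F L k)) => [L L' LL'|].
  by apply: bdriesS => s _; apply: LL'.
by rewrite /bdries chainsp0 limg0.
Qed.

Local Notation Z := (fun r => cycles F (filt p K r) k).
Local Notation B := (fun r => bdries F (filt p K r) k).

Lemma rank_mapE (L M : pred {set 'I_n}) :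
  rank_map F L M k = (\dim (cycles F L k) - \dim (cycles F L k :&: bdries F M k))%N.
Proof. by rewrite /rank_map; have := dimv_sum_cap (cycles F L k) (bdries F M k); lia. Qed.

Lemma rkv0E i b : rkv0 F p K k i b =
  (\dim (step_value t Z i) - \dim (step_value t Z i :&: bdries F (filt p K (nth 0%R t b)) k))%N%:Z.
Proof. by case: i => [|i] /=; rewrite ?cap0v ?dimv0 // /rkv rank_mapE. Qed.

(** Ranks are [\dim Z - \dim (Z :&: B)], so the terms [\dim Z] cancel in the alternating sum; by
    supermodularity it is nonnegative, so the absolute value changes nothing. *)
Lemma mult_finE i j : (i < j < size t)%N -> `|mult_fin F p K k i j|%N = pts_mult t Z t B i j.
Proof.
case: j => // j /andP[ij jt]; have it : (i < size t)%N by lia.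
have jt' := ltnW jt.
have sZ : (step_value t Z i <= step_value t Z i.+1)%VS.
  by rewrite (step_valueS step_cycles) // leqnSn.
have sB := death_valueS step_bdries j.+1.
have := dimv_cap_supermodular sZ sB.
have := dimvS (capvS sZ (subvv (death_value t B j.+1))).
have := dimvS (capvS sZ (subvv (death_value t B j.+2))).
have := dimvS (capvS (subvv (step_value t Z i)) sB).
have := dimvS (capvS (subvv (step_value t Z i.+1)) sB).
have := dimvS (capvSl (step_value t Z i) (death_value t B j.+1)).
have := dimvS (capvSl (step_value t Z i.+1) (death_value t B j.+1)).
have := dimvS (capvSl (step_value t Z i) (death_value t B j.+2)).
have := dimvS (capvSl (step_value t Z i.+1) (death_value t B j.+2)).
rewrite /pts_mult /mult_fin !rkv0E /rkv !rank_mapE /death_value jt jt' /=.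
lia.
Qed.

Lemma mult_infE i : (i < size t)%N -> `|mult_inf F p K k i|%N = pts_mult t Z t B i (size t).
Proof.
move=> it; have sZ : (step_value t Z i <= step_value t Z i.+1)%VS.
  by rewrite (step_valueS step_cycles) // leqnSn.
have tpos : (0 < size t)%N by lia.
have := dimv_cap_supermodular sZ (death_valueS step_bdries (size t)).
have := dimvS sZ.
have := dimvS (capvS sZ (subvv (death_value t B (size t)))).
have := dimvS (capvSl (step_value t Z i) (death_value t B (size t))).
have := dimvS (capvSl (step_value t Z i.+1) (death_value t B (size t))).
rewrite /pts_mult /mult_inf !rkv0E /rkv !rank_mapE /death_value ltnn !capvf.
case: (size t) tpos => // m _; rewrite ltnSn /=.
lia.
Qed.

Lemma dgm_pts : perm_eq (dgm F p K k) (pts t Z t B).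
Proof.
apply/permP => P; rewrite count_pts /dgm count_cat !count_flatten !sumnE !big_map.
rewrite big_allpairs_dep.
transitivity (\sum_(0 <= i < size t)
  ((\sum_(i.+1 <= j < size t) P (nth 0%R t i, (nth 0%R t j)%:E) * pts_mult t Z t B i j) +
   P (nth 0%R t i, +oo%E) * pts_mult t Z t B i (size t)))%N.
  rewrite big_split; congr addn; rewrite /index_iota subn0.
    apply: eq_big_seq => i; rewrite mem_iota => /= it; apply: eq_big_seq => j.
    rewrite mem_iota => ijt; rewrite count_nseq mult_finE //; lia.
  apply: eq_big_seq => i; rewrite mem_iota => /= it; rewrite count_nseq mult_infE //.
apply: eq_big_nat => i /= it.
have dS : death_time t (size t) = +oo%E by rewrite /death_time ltnn.
rewrite [RHS]big_mkcond big_nat_recr //= dS ltry; congr addn.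
rewrite (big_nat_widenl _ 0) // big_mkcond; apply: eq_big_nat => j /= jt.
have -> : death_time t j = (nth 0 t j)%:E by rewrite /death_time jt.
rewrite lte_fin; congr (if _ then _ else _).
by rewrite (lt_sorted_ltn_nth 0 crit_sorted) ?inE.
Qed.

End DiagramPoints.

(** * Logarithmic costs of matched and unmatched bars *)

Section LogCost.
Variables (R : realType) (c : R).
Hypothesis c1 : 1 <= c.
Local Open Scope ereal_scope.

Let c0 : (0 < c)%R. Proof. exact: lt_le_trans c1. Qed.
Let lnc0 : (0 <= ln c)%R. Proof. exact: ln_ge0. Qed.

Lemma ln_ratio (x y : R) : (0 < y)%R -> (0 < x)%R -> (x <= c * y)%R -> (ln x - ln y <= ln c)%R.
Proof.
move=> y0 x0 xcy; rewrite lerBlDr -lnM ?posrE // ler_ln ?posrE // mulr_gt0 //.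
Qed.

Lemma ecoord_dist_log (x y : \bar R) : 0 <= y -> y <= x -> x <= c%:E * y ->
  ecoord_dist (elog x) (elog y) <= (ln c)%:E.
Proof.
case: y => [y| |] //; last by rewrite leye_eq => _ /eqP -> _; rewrite /ecoord_dist eqxx lee_fin.
case: x => [x| |]; rewrite ?leeNy_eq ?leye_eq // !lee_fin => y0 yx xy.
(* If [y = 0] then [x = 0], and both logarithms are [-oo], at distance 0. *)
rewrite /ecoord_dist /elog; have [ye|yn] := eqVneq y 0%R.
  have -> : x = 0%R by apply: le_anti; rewrite ye mulr0 in xy; rewrite xy -ye.
  by rewrite eqxx lee_fin.
have {}y0 : (0 < y)%R by rewrite lt_neqAle eq_sym yn.
have x0 : (0 < x)%R := lt_le_trans y0 yx.
rewrite (gt_eqF x0); case: ifP => _; first by rewrite lee_fin.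
rewrite lee_fin ger0_norm ?subr_ge0 ?ler_ln ?posrE //.
exact: ln_ratio.
Qed.

Lemma diag_cost_log (x : R * \bar R) : (0 <= x.1)%R -> x.1%:E < x.2 -> short_bar c x ->
  diag_cost (elog x.1%:E, elog x.2) <= (ln c)%:E.
Proof.
case: x => a [b| |] //=; rewrite /short_bar /= ?lte_fin ?lee_fin ?leye_eq // => a0 ab bca.
(* A bar of positive length born at 0 is not short, so the logarithms are finite. *)
have an : a != 0%R by apply: contraTneq bca => ->; rewrite mulr0 -ltNge; apply: le_lt_trans ab.
have {}a0 : (0 < a)%R by rewrite lt_neqAle eq_sym an.
have b0 : (0 < b)%R := lt_trans a0 ab.
rewrite /diag_cost /= (gt_eqF a0) (gt_eqF b0) lee_fin.
have := ln_ratio a0 b0 bca; have := lnc0; lra.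
Qed.

Lemma big_maxe_le (I : eqType) (s : seq I) (P : pred I) (f : I -> \bar R) (x : \bar R) :
  0 <= x -> (forall i, i \in s -> P i -> f i <= x) -> \big[maxe/0]_(i <- s | P i) f i <= x.
Proof.
move=> x0 H; rewrite big_seq_cond; elim/big_ind: _ => // [a b ax bx|i /andP[]].
  by rewrite ge_max ax.
exact: H.
Qed.

End LogCost.

Theorem theorem1 (R : realType) (F : fieldType) (d n : nat)
    (p : 'I_n -> 'rV[R]_d) (k : nat) :
  injective p -> general_position p ->
  mult_strongly_interleaved F (rips p) (drips p) k (cconst R k.+1) /\
  (bottleneck (logdgm (dgm F p (is_del p) k))
              (logdgm (dgm F p (rips_cplx (n:=n)) k))
     <= (ln (cconst R k.+1))%:E)%E.
Proof.
move=> _ _; split; first exact: rips_drips_interleaved.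
set c := cconst R k.+1; have c1 : 1 <= c by exact: cconst_ge1.
have c0 : 0 < c by exact: lt_le_trans c1.
set D1 := dgm F p (is_del p) k; set D2 := dgm F p (@rips_cplx n) k.
have p1 : perm_eq D1 _ := dgm_pts F p (is_del p) k.
have p2 : perm_eq D2 _ := dgm_pts F p (@rips_cplx n) k.
(* Delaunay-Rips takes the role of [V], Rips that of [W]. *)
have [||||m [um1 um2 mP m1 m2]] := diagram_matching c1 (step_cycles F p _ k)
  (step_bdries F p _ k) (step_cycles F p _ k) (step_bdries F p _ k)
  (@crit_ge0 R d n p _) (@crit_ge0 R d n p _) _ _ _ _ p1 p2.
- by move=> a; apply: cyclesS => Q _; apply: drips_rips.
- by move=> a; apply: bdriesS => Q _; apply: drips_rips.
- exact: rips_cycles_sub.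
- by move=> a a0; apply: drips_rips_bdries_sub.
pose x0 : R * \bar R := (0, 0%E).
have mem1 i : (i < size D1)%N -> 0 <= (nth x0 D1 i).1 /\
    ((nth x0 D1 i).1%:E < (nth x0 D1 i).2)%E.
  move=> iD; have := mem_nth x0 iD; rewrite (perm_mem p1) => /mem_pts[xt _ ?].
  by split=> //; apply: crit_ge0 xt.
have mem2 i : (i < size D2)%N -> 0 <= (nth x0 D2 i).1 /\
    ((nth x0 D2 i).1%:E < (nth x0 D2 i).2)%E.
  move=> iD; have := mem_nth x0 iD; rewrite (perm_mem p2) => /mem_pts[xt _ ?].
  by split=> //; apply: crit_ge0 xt.
have lnc : (0 <= (ln c)%:E)%E by rewrite lee_fin ln_ge0.
apply: (@le_trans _ _ (mcost (logdgm D1) (logdgm D2) m)).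
  apply: ereal_inf_lbound; exists m => //; rewrite /pmatching um1 um2 /=.
  by apply/allP => ij /mP[]; rewrite !size_map => -> ->.
have nthlog D i : (i < size D)%N -> nth (0, 0)%E (logdgm D) i =
    (elog (nth x0 D i).1%:E, elog (nth x0 D i).2).
  by move=> iD; rewrite (nth_map x0).
rewrite /mcost !ge_max; apply/and3P; split; apply: big_maxe_le => //.
- move=> ij /mP[i1 i2 [y1 x1 y2 x2]] _; rewrite !nthlog // /pt_cost ge_max.
  have [b0 bd] := mem2 _ i2.
  apply/andP; split; apply: ecoord_dist_log; rewrite ?lee_fin //.
  by apply: le_trans (ltW bd); rewrite lee_fin.
- move=> i; rewrite mem_iota size_map => /= iD nm; rewrite nthlog //.
  have [b0 bd] := mem1 _ iD; apply: diag_cost_log => //; exact: m1.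
- move=> i; rewrite mem_iota size_map => /= iD nm; rewrite nthlog //.
  have [b0 bd] := mem2 _ iD; apply: diag_cost_log => //; exact: m2.
Qed.
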